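(* Let $K$ be a field, let $0<a<b<c$ be integers, and let $I=(x^c,\,x^by^a,\,x^ay^b,\,y^c)\subset K[x,y]$ with fiber cone $F(I)$. (a) If $2a\ge c$, then (i) $F(I)\cong K[z_1,z_2,z_3,z_4]/(z_2z_3,\,z_2^2,\,z_3^2)$, (ii) $\mathrm{Hilb}_{F(I)}(t)=(1+2t)/(1-t)^2$, (iii) $F(I)$ is Cohen--Macaulay. (b) If $c>r(b-a)+a$, where $r=\lceil b/(b-a)\rceil$, then (i) $F(I)\cong K[z_1,z_2,z_3,z_4]/(z_1z_3^{r-1},\,z_2^{r-1}z_4,\,z_1z_4)$, (ii) $\mathrm{Hilb}_{F(I)}(t)=\bigl(1+2\sum_{i=1}^{r-1}t^i\bigr)/(1-t)^2$, (iii) $F(I)$ is Cohen--Macaulay.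
   Context: With $\mathfrak m=(x,y)\subset K[x,y]$, the fiber cone of an ideal $I$ is the standard graded $K$-algebra $F(I)=R(I)/\mathfrak mR(I)=\bigoplus_{k\ge0}I^k/\mathfrak mI^k$, where $R(I)=\bigoplus_{k\ge0}I^k$ is the Rees ring. $\mathrm{Hilb}_{F(I)}(t)=\sum_{k\ge0}\dim_K F(I)_k\,t^k$ is its Hilbert series. The isomorphisms are induced by mapping $z_1,z_2,z_3,z_4$ to the residue classes in $F(I)_1=I/\mathfrak mI$ of $x^c,\,x^by^a,\,x^ay^b,\,y^c$, respectively. *)

(* Defs.v *)
From HB Require Import structures.
From mathcomp Require Import all_boot all_order all_algebra ring_quotient.
From mathcomp.classical Require Import boolp.
From mathcomp.multinomials Require Import mpoly.

Set Implicit Arguments.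
Unset Strict Implicit.
Unset Printing Implicit Defensive.

Import GRing.Theory.
Local Open Scope ring_scope.
Local Open Scope quotient_scope.

Section Ideals.
Variable R : comPzRingType.
Implicit Types (S I J P : R -> Prop).

Definition ideal_gen S (x : R) : Prop :=
  exists n (c s : 'I_n -> R), (forall i, S (s i)) /\ x = \sum_i c i * s i.

Lemma ideal_gen0 S : ideal_gen S 0.
Proof.
exists 0, (fun=> 0), (fun=> 0); split; first by case.
by rewrite big_ord0.
Qed.

Lemma ideal_genD S x y : ideal_gen S x -> ideal_gen S y -> ideal_gen S (x + y).
Proof.
move=> [n1 [c1 [s1 [h1 ->]]]] [n2 [c2 [s2 [h2 ->]]]].
exists (n1 + n2)%N,
  (fun i => match split i with inl j => c1 j | inr j => c2 j end),
  (fun i => match split i with inl j => s1 j | inr j => s2 j end); split.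
  by move=> i; case: (split i).
rewrite big_split_ord /=; congr (_ + _); apply: eq_bigr => i _.
  by rewrite (unsplitK (inl i)).
by rewrite (unsplitK (inr i)).
Qed.

Lemma ideal_genM S u x : ideal_gen S x -> ideal_gen S (u * x).
Proof.
move=> [n [c [s [h ->]]]]; exists n, (fun i => u * c i), s; split=> //.
by rewrite mulr_sumr; apply: eq_bigr => i _; rewrite mulrA.
Qed.

Lemma ideal_gen_mem S x : S x -> ideal_gen S x.
Proof.
by move=> Sx; exists 1, (fun=> 1), (fun=> x); split=> //; rewrite big_ord1 mul1r.
Qed.

Lemma ideal_gen_sum S n (F : 'I_n -> R) :
  (forall i, ideal_gen S (F i)) -> ideal_gen S (\sum_i F i).
Proof.
move=> h; elim/big_ind: _ => //; [exact: ideal_gen0|exact: ideal_genD].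
Qed.

Definition is_prime_ideal P : Prop :=
  [/\ P 0 /\ ~ P 1, forall x y, P x -> P y -> P (x + y),
      forall u x, P x -> P (u * x) & forall x y, P (x * y) -> P x \/ P y].

Definition prime_chain (n : nat) (C : nat -> R -> Prop) : Prop :=
  (forall i, (i <= n)%N -> is_prime_ideal (C i)) /\
  (forall i, (i < n)%N ->
     (forall x, C i x -> C i.+1 x) /\ (exists x, C i.+1 x /\ ~ C i x)).

Definition krull_dim (n : nat) : Prop :=
  (exists C, prime_chain n C) /\ forall n' C, prime_chain n' C -> (n' <= n)%N.

Definition ideal_mul I J : R -> Prop :=
  ideal_gen (fun x => exists u v, [/\ I u, J v & x = u * v]).

Fixpoint ideal_exp I (k : nat) : R -> Prop :=
  if k is k'.+1 then ideal_mul I (ideal_exp I k') else fun=> True.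

Lemma ideal_exp0 I k : ideal_exp I k 0.
Proof. by case: k => // k; apply: ideal_gen0. Qed.

Lemma ideal_expD I k x y :
  ideal_exp I k x -> ideal_exp I k y -> ideal_exp I k (x + y).
Proof. by case: k => // k; apply: ideal_genD. Qed.

Lemma ideal_expM I k u x : ideal_exp I k x -> ideal_exp I k (u * x).
Proof. by case: k => // k; apply: ideal_genM. Qed.

Lemma ideal_exp_mul I i j x y :
  ideal_exp I i x -> ideal_exp I j y -> ideal_exp I (i + j) (x * y).
Proof.
elim: i x => [|i IHi] x; first by move=> _; apply: ideal_expM.
move=> [n [c [s [h ->]]]] Ijy; rewrite mulr_suml addSn.
apply: ideal_gen_sum => l; have [u [v [Iu Iv ->]]] := h l.
rewrite -mulrA; apply: ideal_genM; apply: ideal_gen_mem.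
by exists u, (v * y); split=> //; [exact: IHi|rewrite mulrA].
Qed.

Lemma ideal_exp1 I x : I x -> ideal_exp I 1 x.
Proof. by move=> Ix; apply: ideal_gen_mem; exists x, 1; rewrite mulr1. Qed.

Definition regular_seq (s : seq R) : Prop :=
  (forall i, (i < size s)%N -> forall x,
     ideal_gen (fun y => y \in take i s) (nth 0 s i * x) ->
     ideal_gen (fun y => y \in take i s) x) /\
  ~ ideal_gen (fun y => y \in s) 1.

End Ideals.

(* The ring quotients of ring_quotient.v require a proof that the ideal is
   proper; R/(S) is built here for an arbitrary set S of generators. *)
Section QuotientRing.
Variables (R : comPzRingType) (S : R -> Prop).

Definition ideal_pred : {pred R} := fun x => `[< ideal_gen S x >].

Fact ideal_pred_closed : zmod_closed ideal_pred.
Proof.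
split=> [|x y /asboolP hx /asboolP hy]; apply/asboolP; first exact: ideal_gen0.
by apply: ideal_genD => //; rewrite -mulN1r; apply: ideal_genM.
Qed.

HB.instance Definition _ := GRing.isZmodClosed.Build R ideal_pred ideal_pred_closed.

Definition quotient_ring : Type := Quotient.quot ideal_pred.
HB.instance Definition _ := GRing.Zmodule.on quotient_ring.

Definition quotient_proj (x : R) : quotient_ring := \pi_(Quotient.quot ideal_pred) x.

Lemma quotient_proj_eq x y :
  quotient_proj x = quotient_proj y <-> ideal_gen S (x - y).
Proof.
split; first by move/eqP; rewrite -Quotient.idealrBE => /asboolP.
by move=> h; apply/eqP; rewrite -Quotient.idealrBE; apply/asboolP.
Qed.

Definition quotient_repr (x : quotient_ring) : R := repr (x : Quotient.quot ideal_pred).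

Lemma quotient_reprK : cancel quotient_repr quotient_proj.
Proof. by move=> x; apply: reprK. Qed.

Fact quotient_proj_zmod : zmod_morphism quotient_proj.
Proof. by move=> x y; rewrite /quotient_proj Quotient.pi_add Quotient.pi_opp. Qed.

HB.instance Definition _ :=
  GRing.isZmodMorphism.Build R quotient_ring quotient_proj quotient_proj_zmod.

Definition quotient_mul (x y : quotient_ring) : quotient_ring :=
  quotient_proj (quotient_repr x * quotient_repr y).

Lemma quotient_projM x y :
  quotient_proj (x * y) = quotient_mul (quotient_proj x) (quotient_proj y).
Proof.
apply/quotient_proj_eq; set x' := quotient_repr _; set y' := quotient_repr _.
have hx : ideal_gen S (x - x') by apply/quotient_proj_eq; rewrite quotient_reprK.
have hy : ideal_gen S (y - y') by apply/quotient_proj_eq; rewrite quotient_reprK.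
have -> : x * y - x' * y' = y * (x - x') + x' * (y - y').
  by rewrite !mulrBr addrA [y * x]mulrC [y * x']mulrC subrK.
by apply: ideal_genD; apply: ideal_genM.
Qed.

Fact quotient_mulA : associative quotient_mul.
Proof.
move=> x y z; rewrite -[x]quotient_reprK -[y]quotient_reprK -[z]quotient_reprK.
by rewrite -!quotient_projM mulrA.
Qed.

Fact quotient_mulC : commutative quotient_mul.
Proof. by move=> x y; rewrite /quotient_mul mulrC. Qed.

Fact quotient_mul1 : left_id (quotient_proj 1) quotient_mul.
Proof. by move=> x; rewrite -[x]quotient_reprK -quotient_projM mul1r. Qed.

Fact quotient_mulDl : left_distributive quotient_mul +%R.
Proof.
move=> x y z; rewrite -[x]quotient_reprK -[y]quotient_reprK -[z]quotient_reprK.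
by rewrite -raddfD -!quotient_projM mulrDl raddfD.
Qed.

HB.instance Definition _ := GRing.Zmodule_isComPzRing.Build quotient_ring
  quotient_mulA quotient_mulC quotient_mul1 quotient_mulDl.

Fact quotient_proj_monoid : monoid_morphism quotient_proj.
Proof. by split=> // x y; rewrite quotient_projM. Qed.

HB.instance Definition _ :=
  GRing.isMonoidMorphism.Build R quotient_ring quotient_proj quotient_proj_monoid.

End QuotientRing.

Section QuotientAlgebra.
Variables (K : fieldType) (R : comAlgType K) (S : R -> Prop).
Local Notation Q := (quotient_ring S).
Local Notation pi := (@quotient_proj R S).

Definition quotient_scale (k : K) (x : Q) : Q := pi k%:A * x.

Fact quotient_scalerA k l x :
  quotient_scale k (quotient_scale l x) = quotient_scale (k * l) x.
Proof. by rewrite /quotient_scale mulrA -rmorphM -scalerAl mul1r scalerA. Qed.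

Fact quotient_scale1r : left_id 1 quotient_scale.
Proof. by move=> x; rewrite /quotient_scale scale1r rmorph1 mul1r. Qed.

Fact quotient_scalerDr : right_distributive quotient_scale +%R.
Proof. by move=> k x y; rewrite /quotient_scale mulrDr. Qed.

Fact quotient_scalerDl x : {morph quotient_scale^~ x : k l / k + l}.
Proof. by move=> k l; rewrite /quotient_scale scalerDl rmorphD mulrDl. Qed.

HB.instance Definition _ := GRing.Zmodule_isLmodule.Build K Q
  quotient_scalerA quotient_scale1r quotient_scalerDr quotient_scalerDl.

End QuotientAlgebra.

(* R(I) as the subring of A[T] of the polynomials whose coefficient of T^k lies
   in I^k, for every k. *)
Section Rees.
Variables (K : fieldType) (A : comAlgType K) (I : A -> Prop).

Definition rees_pred : {pred {poly A}} := fun p => `[< forall k, ideal_exp I k p`_k >].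

Fact rees_closed : subring_closed rees_pred.
Proof.
split=> [|p q /asboolP hp /asboolP hq|p q /asboolP hp /asboolP hq];
  apply/asboolP=> k.
- by case: k => // k; rewrite coefC; apply: ideal_exp0.
- rewrite coefB; apply: ideal_expD => //.
  by rewrite -mulN1r; apply: ideal_expM.
- rewrite coefM; elim/big_ind: _; [exact: ideal_exp0|exact: ideal_expD|].
  move=> i _; rewrite -{1}[k](subnKC (leq_ord i)); exact: ideal_exp_mul.
Qed.

HB.instance Definition _ :=
  GRing.isSubringClosed.Build {poly A} rees_pred rees_closed.

Record rees := Rees { rees_val :> {poly A}; _ : rees_val \in rees_pred }.

HB.instance Definition _ := [isSub for rees_val].
HB.instance Definition _ := [Choice of rees by <:].
HB.instance Definition _ := [SubChoice_isSubComNzRing of rees by <:].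

Lemma rees_val_inj : injective rees_val.
Proof. exact: val_inj. Qed.

Lemma rees_valD p q : rees_val (p + q) = rees_val p + rees_val q.
Proof. by []. Qed.

Lemma rees_valM p q : rees_val (p * q) = rees_val p * rees_val q.
Proof. exact: (rmorphM (\val : rees -> {poly A})). Qed.

Fact rees_mon_subproof k f : ideal_exp I k f -> f *: 'X^k \in rees_pred.
Proof.
move=> hf; apply/asboolP=> j; rewrite coefZ coefXn.
by case: eqP => [->|_]; rewrite ?mulr1 // mulr0; apply: ideal_exp0.
Qed.

(* The element f T^k of R(I), for f in I^k. *)
Definition rees_mon k f (hf : ideal_exp I k f) : rees := Rees (rees_mon_subproof hf).

Definition rees_scale (k : K) (p : rees) : rees :=
  @rees_mon 0 k%:A Logic.I * p.

Lemma rees_scaleE k p : rees_val (rees_scale k p) = k%:A *: rees_val p.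
Proof. by rewrite /rees_scale rees_valM /= expr0 -scalerAl mul1r. Qed.

Fact rees_scalerA k l p : rees_scale k (rees_scale l p) = rees_scale (k * l) p.
Proof.
by apply: rees_val_inj; rewrite !rees_scaleE scalerA -scalerAl mul1r scalerA.
Qed.

Fact rees_scale1r : left_id 1 rees_scale.
Proof. by move=> p; apply: rees_val_inj; rewrite rees_scaleE !scale1r. Qed.

Fact rees_scalerDr : right_distributive rees_scale +%R.
Proof. by move=> k p q; rewrite /rees_scale mulrDr. Qed.

Fact rees_scalerDl p : {morph rees_scale^~ p : k l / k + l}.
Proof. by move=> k l; apply: rees_val_inj; rewrite rees_valD !rees_scaleE !scalerDl. Qed.

HB.instance Definition _ := GRing.Zmodule_isLmodule.Build K rees
  rees_scalerA rees_scale1r rees_scalerDr rees_scalerDl.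

Fact rees_scalerAl (k : K) (p q : rees) : k *: (p * q) = (k *: p) * q.
Proof. exact: mulrA. Qed.

HB.instance Definition _ := GRing.Lmodule_isLalgebra.Build K rees rees_scalerAl.
HB.instance Definition _ := GRing.Lalgebra_isComAlgebra.Build K rees.

End Rees.

Section FiberCone.
Variables (K : fieldType) (A : comAlgType K) (m I : A -> Prop).

(* The set generating m R(I). *)
Definition rees_extend (p : rees I) : Prop := exists2 u, m u & rees_val p = u%:P.

Definition fiber_cone : Type := quotient_ring rees_extend.
HB.instance Definition _ := GRing.ComPzRing.on fiber_cone.
HB.instance Definition _ := GRing.Lmodule.on fiber_cone.

Definition fiber_class k f (hf : ideal_exp I k f) : fiber_cone :=
  quotient_proj rees_extend (rees_mon hf).

(* F(I)_k, the image of I^k T^k, which is isomorphic to I^k / m I^k. *)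
Definition fiber_comp (k : nat) (y : fiber_cone) : Prop :=
  exists f (hf : ideal_exp I k f), y = fiber_class hf.

End FiberCone.

Section Graded.
Variables (R : comPzRingType) (comp : nat -> R -> Prop).

Definition homogeneous (x : R) : Prop := exists k, comp k x.

(* For a standard graded K-algebra this is the graded maximal ideal. *)
Definition irrelevant_ideal : R -> Prop :=
  ideal_gen (fun x => exists2 k, (0 < k)%N & comp k x).

Definition homogeneous_regular_seq (s : seq R) : Prop :=
  (forall x, x \in s -> homogeneous x /\ irrelevant_ideal x) /\ regular_seq s.

Definition graded_depth (n : nat) : Prop :=
  (exists s, homogeneous_regular_seq s /\ size s = n) /\
  forall s, homogeneous_regular_seq s -> (size s <= n)%N.

(* The convention for standard graded K-algebras: depth is the largest length of
   a homogeneous regular sequence in the graded maximal ideal, and the algebra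
   is Cohen-Macaulay when depth and Krull dimension agree. Such algebras are
   automatically Noetherian. *)
Definition graded_cohen_macaulay : Prop :=
  exists d, krull_dim R d /\ graded_depth d.

End Graded.

Section Hilbert.
Variables (K : fieldType) (V : lmodType K).

Definition has_dim (W : V -> Prop) (n : nat) : Prop :=
  exists e : 'I_n -> V,
    (forall c : 'I_n -> K, \sum_i c i *: e i = 0 -> forall i, c i = 0) /\
    (forall v, W v <-> exists c : 'I_n -> K, v = \sum_i c i *: e i).

Definition is_hilbert_series (W : nat -> V -> Prop) (H : nat -> nat) : Prop :=
  forall k, has_dim (W k) (H k).

End Hilbert.

(* The formal power series sum_n H_n t^n equals P / Q in Z[[t]]; meaningful
   when Q has constant term 1. *)
Definition series_eq_frac (H : nat -> nat) (P Q : {poly int}) : Prop :=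
  forall n, \sum_(i < n.+1) Q`_i * (H (n - i)%N)%:R = P`_n.

Section FourGenerated.
Variables (K : fieldType) (a b c : nat).

Local Notation x := ('X_(inord 0) : {mpoly K[2]}).
Local Notation y := ('X_(inord 1) : {mpoly K[2]}).

Definition max_ideal : {mpoly K[2]} -> Prop := ideal_gen (fun p => p \in [:: x; y]).

Definition gens : 4.-tuple {mpoly K[2]} :=
  [tuple x ^+ c; x ^+ b * y ^+ a; x ^+ a * y ^+ b; y ^+ c].

Definition monI : {mpoly K[2]} -> Prop := ideal_gen (fun p => p \in gens).

Fact gens_mem i : ideal_exp monI 1 (tnth gens i).
Proof. by apply: ideal_exp1; apply: ideal_gen_mem; apply: mem_tnth. Qed.

Definition fiberF := fiber_cone max_ideal monI.
HB.instance Definition _ := GRing.ComPzRing.on fiberF.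
HB.instance Definition _ := GRing.Lmodule.on fiberF.

Definition fiberF_gen (i : 'I_4) : fiberF := fiber_class max_ideal (gens_mem i).

Definition fiberF_comp : nat -> fiberF -> Prop := @fiber_comp _ _ max_ideal monI.

(* F(I) is isomorphic, as a K-algebra, to K[z_1, .., z_4] / (J), through the map
   sending z_i to the class of the i-th generator of I. *)
Definition fiberF_presented_by (J : seq {mpoly K[4]}) : Prop :=
  exists phi : {rmorphism quotient_ring (fun p => p \in J) -> fiberF},
    [/\ scalable phi, bijective phi &
        forall i, phi (quotient_proj _ 'X_i) = fiberF_gen i].

Definition fiberF_hilbert_eq (P Q : {poly int}) : Prop :=
  exists H, is_hilbert_series fiberF_comp H /\ series_eq_frac H P Q.

Definition fiberF_cohen_macaulay : Prop := graded_cohen_macaulay fiberF_comp.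

End FourGenerated.

(* The variable z_i, numbered from 1. *)
Definition zvar (K : fieldType) (i : nat) : {mpoly K[4]} := 'X_(inord i.-1).

(* Main.v *)
(* A product of k generators of I vanishes in F(I) exactly when it is a proper
   multiple of another product of k generators. A monomial of K[z1, .., z4] that
   is divisible by none of the listed relations ("normal") maps to a monomial of
   K[x, y], and among the normal monomials of a given degree these images form an
   antichain for divisibility. The coefficient of such an image vanishes on
   m R(I), so the normal monomials form a K-basis of F(I); this gives the
   presentation, and counting gives the Hilbert series.

   For Cohen-Macaulayness, take the parameters z1, z4 in case (a), with module
   basis 1, z2, z3, and z1 + z3, z2 + z4 in case (b), with module basis
   1, z3^l, z2^l (0 < l < r). The products of these basis elements with the
   monomials in the parameters span F(I); there are as many of them as normal
   monomials in each filtration degree, so they are free, F(I) is free over the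
   polynomial ring in the parameters, and the parameters form a regular sequence.

   Since the dimension of F(I)_k grows linearly, any x0, x1, x2 in F(I) are
   algebraically dependent. Factoring a relation by its lexicographically lowest
   monomial gives
     x0^m0 (x1^m1 (x2^m2 (1 + a2 x2) + a1 x1) + a0 x0) = 0,
   which excludes at once a prime chain of length 3 and a regular sequence of
   length 3. *)
From HB Require Import structures.
Require Import Defs.
From mathcomp Require Import all_boot all_order all_algebra zify ring.
From mathcomp.classical Require Import boolp.
From mathcomp.multinomials Require Import mpoly.

Set Implicit Arguments.
Unset Strict Implicit.
Unset Printing Implicit Defensive.

Import GRing.Theory Num.Theory.
Local Open Scope ring_scope.

(** * Finite families of vectors *)

Section FiniteFamilies.
Variables (K : fieldType) (V : lmodType K).

Definition in_span (T : finType) (v : T -> V) (y : V) : Prop :=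
  exists c : T -> K, y = \sum_t c t *: v t.

Definition lin_free (T : finType) (v : T -> V) : Prop :=
  forall c : T -> K, \sum_t c t *: v t = 0 -> forall t, c t = 0.

Lemma in_span0 (T : finType) (v : T -> V) : in_span v 0.
Proof. by exists (fun=> 0); rewrite big1 // => t _; rewrite scale0r. Qed.

Lemma in_spanD (T : finType) (v : T -> V) x y :
  in_span v x -> in_span v y -> in_span v (x + y).
Proof.
move=> [c ->] [d ->]; exists (fun t => c t + d t).
by rewrite -big_split; apply: eq_bigr => t _; rewrite scalerDl.
Qed.

Lemma in_spanZ (T : finType) (v : T -> V) k x :
  in_span v x -> in_span v (k *: x).
Proof.
move=> [c ->]; exists (fun t => k * c t).
by rewrite scaler_sumr; apply: eq_bigr => t _; rewrite scalerA.
Qed.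

Lemma in_span_mem (T : finType) (v : T -> V) t : in_span v (v t).
Proof.
exists (fun u => (u == t)%:R); rewrite (bigD1 t) //= eqxx scale1r.
by rewrite big1 ?addr0 // => u /negbTE ->; rewrite scale0r.
Qed.

Lemma in_span_sum (T : finType) (v : T -> V) (I : Type) (s : seq I) (P : pred I) F :
  (forall i, P i -> in_span v (F i)) -> in_span v (\sum_(i <- s | P i) F i).
Proof.
move=> h; elim/big_ind: _ => //; [exact: in_span0|exact: in_spanD].
Qed.

Lemma in_span_trans (T S : finType) (v : T -> V) (w : S -> V) y :
  (forall t, in_span w (v t)) -> in_span v y -> in_span w y.
Proof. by move=> h [c ->]; apply: in_span_sum => t _; apply: in_spanZ. Qed.

Lemma sum_enum_val (T : finType) (F : T -> V) :
  \sum_t F t = \sum_(i < #|T|) F (enum_val i).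
Proof. by rewrite -big_enum_val. Qed.

(** The rows of [A] are the coordinates of the vectors [v] in the family [w]. A row killed by [A] is
    a linear relation among the [v], hence zero. *)
Lemma lin_free_matrix (T S : finType) (v : T -> V) (w : S -> V) :
  lin_free v -> (forall t, in_span w (v t)) ->
  exists2 A : 'M[K]_(#|T|, #|S|), row_free A &
    forall u : 'rV_(#|T|), \sum_(i < #|T|) u 0 i *: v (enum_val i) =
      \sum_(j < #|S|) (u *m A) 0 j *: w (enum_val j).
Proof.
move=> fv /choice[A vA].
pose M : 'M[K]_(#|T|, #|S|) := \matrix_(i, j) A (enum_val i) (enum_val j).
have uM (u : 'rV_#|T|) : \sum_(i < #|T|) u 0 i *: v (enum_val i) =
    \sum_(j < #|S|) (u *m M) 0 j *: w (enum_val j).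
  transitivity (\sum_(i < #|T|) \sum_(j < #|S|)
      (u 0 i * M i j) *: w (enum_val j)).
    apply: eq_bigr => i _; rewrite vA sum_enum_val scaler_sumr.
    by apply: eq_bigr => j _; rewrite scalerA mxE.
  rewrite exchange_big; apply: eq_bigr => j _.
  by rewrite mxE scaler_suml.
exists M => //; apply: inj_row_free => u uM0.
have := uM u; rewrite uM0 [RHS]big1; last by move=> j _; rewrite mxE scale0r.
move=> u0; have/fv cu : \sum_t u 0 (enum_rank t) *: v t = 0.
  by rewrite sum_enum_val -[RHS]u0; apply: eq_bigr => i _; rewrite enum_valK.
by apply/rowP=> i; rewrite -[i]enum_valK cu mxE.
Qed.

Lemma lin_free_card (T S : finType) (v : T -> V) (w : S -> V) :
  lin_free v -> (forall t, in_span w (v t)) -> (#|T| <= #|S|)%N.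
Proof.
move=> fv vw; have [A fA _] := lin_free_matrix fv vw.
by rewrite -{1}(eqP fA) rank_leq_col.
Qed.

(** Both families have the same index type, so the row-free coordinate matrix is square and
    invertible. A relation [d] among the [w] is then [u *m A] for some [u], which is a relation
    among the [v], so [u] and [d] vanish. *)
Lemma lin_free_exchange (T : finType) (v w : T -> V) :
  lin_free v -> (forall t, in_span w (v t)) -> lin_free w.
Proof.
move=> fv vw c; have [A fA uA] := lin_free_matrix fv vw.
rewrite sum_enum_val => c0 t.
pose d := \row_(i < #|T|) c (enum_val i).
have /submxP[u dE] : (d <= A)%MS by apply: submx_full; rewrite /row_full.
have := uA u; rewrite -dE.
under [RHS]eq_bigr do rewrite mxE.
rewrite c0 => u0; have/fv cu : \sum_t u 0 (enum_rank t) *: v t = 0.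
  by rewrite sum_enum_val -[RHS]u0; apply: eq_bigr => i _; rewrite enum_valK.
have : d 0 (enum_rank t) = 0.
  have -> : d = 0.
    have u00 : u = 0 by apply/rowP=> i; rewrite -[i]enum_valK cu mxE.
    by rewrite dE u00 mul0mx.
  by rewrite mxE.
by rewrite mxE enum_rankK.
Qed.

Lemma lin_free_has_dim (T : finType) (v : T -> V) (W : V -> Prop) :
  lin_free v -> (forall y, W y <-> in_span v y) -> has_dim W #|T|.
Proof.
move=> fv Wv; exists (fun i => v (enum_val i)); split=> [c c0 i|y].
  have/fv cu : \sum_t c (enum_rank t) *: v t = 0.
    by rewrite sum_enum_val -[RHS]c0; apply: eq_bigr => j _; rewrite enum_valK.
  by rewrite -[i]enum_valK cu.
rewrite Wv; split=> [[c ->]|[c ->]].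
  by exists (fun i => c (enum_val i)); rewrite sum_enum_val.
exists (fun t => c (enum_rank t)); rewrite [RHS]sum_enum_val.
by apply: eq_bigr => j _; rewrite enum_valK.
Qed.

End FiniteFamilies.

(** * Algebraic dependence, prime chains and regular sequences *)

Section Collapse.
Variable R : comPzRingType.

(* Coquand and Lombardi's criterion for Krull dimension at most 2. *)
Definition collapse (x0 x1 x2 : R) : Prop :=
  exists m0 m1 m2 a0 a1 a2,
    x0 ^+ m0 * (x1 ^+ m1 * (x2 ^+ m2 * (1 + a2 * x2) + a1 * x1) + a0 * x0) = 0.

Lemma sum_lowest (N : nat) (F : nat -> R) x i0 :
  (i0 < N)%N -> (forall i, (i < i0)%N -> F i = 0) ->
  exists a, \sum_(i < N) F i * x ^+ i = x ^+ i0 * (F i0 + a * x).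
Proof.
move=> lt_i0N F0; exists (\sum_(i0.+1 <= i < N) F i * x ^+ (i - i0.+1)).
rewrite -(big_mkord xpredT (fun i => F i * x ^+ i)).
rewrite (big_cat_nat (leq0n i0) (ltnW lt_i0N)) /=.
rewrite big_nat big1 ?add0r => [|i /F0 ->]; last by rewrite mul0r.
rewrite big_ltn // mulrDr mulrC; congr (_ + _).
rewrite mulr_suml mulr_sumr [LHS]big_nat [RHS]big_nat.
apply: eq_bigr => i /andP[lt_i0i _].
by rewrite mulrCA -mulrA -exprSr -exprD subnK.
Qed.

(** The exponents [i0], [j0], [k0] are chosen minimal in turn, which singles out the
    lexicographically lowest monomial of the relation. [sum_lowest] then factors the sums over [x0],
    [x1] and [x2] one inside the other. *)
Lemma dependent_collapse (K : fieldType) (iota : {rmorphism K -> R}) (N : nat)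
    (c : nat -> nat -> nat -> K) (x0 x1 x2 : R) :
  (exists i j k, [/\ (i < N)%N, (j < N)%N, (k < N)%N & c i j k != 0]) ->
  \sum_(i < N) (\sum_(j < N) (\sum_(k < N) iota (c i j k) * x2 ^+ k)
     * x1 ^+ j) * x0 ^+ i = 0 ->
  collapse x0 x1 x2.
Proof.
move=> [i1 [j1 [k1 [i1N j1N k1N c1]]]].
have ex3 : exists i, [exists j : 'I_N, [exists k : 'I_N, c i j k != 0]].
  by exists i1; apply/existsP; exists (Ordinal j1N); apply/existsP;
     exists (Ordinal k1N).
case: (ex_minnP ex3) => i0 /existsP[j /existsP[k cjk]] min_i0.
have i0N : (i0 < N)%N.
  by apply: leq_ltn_trans i1N; apply: min_i0; apply/existsP;
     exists (Ordinal j1N); apply/existsP; exists (Ordinal k1N).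
have ex2 : exists j, (j < N)%N && [exists k : 'I_N, c i0 j k != 0].
  by exists j; rewrite ltn_ord; apply/existsP; exists k.
case: (ex_minnP ex2) => j0 /andP[j0N /existsP[k' ck']] min_j0.
have ex1 : exists k, (k < N)%N && (c i0 j0 k != 0).
  by exists k'; rewrite ltn_ord.
case: (ex_minnP ex1) => k0 /andP[k0N ck0] min_k0.
pose G i j := \sum_(k < N) iota (c i j k) * x2 ^+ k.
pose F i := \sum_(j < N) G i j * x1 ^+ j.
have F0 i : (i < i0)%N -> F i = 0.
  move=> lt_i; rewrite /F big1 // => l _; rewrite /G big1 ?mul0r // => q _.
  case: (eqVneq (c i l q) 0) => [->|nz]; first by rewrite rmorph0 mul0r.
  suff: (i0 <= i)%N by rewrite leqNgt lt_i.
  by apply: min_i0; apply/existsP; exists l; apply/existsP; exists q.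
have G0 l : (l < j0)%N -> G i0 l = 0.
  move=> lt_l; rewrite /G big1 // => q _.
  case: (eqVneq (c i0 l q) 0) => [->|nz]; first by rewrite rmorph0 mul0r.
  suff: (j0 <= l)%N by rewrite leqNgt lt_l.
  by apply: min_j0; rewrite (ltn_trans lt_l j0N); apply/existsP; exists q.
have H0 q : (q < k0)%N -> iota (c i0 j0 q) = 0.
  move=> lt_q; case: (eqVneq (c i0 j0 q) 0) => [->|nz]; first exact: rmorph0.
  suff: (k0 <= q)%N by rewrite leqNgt lt_q.
  by apply: min_k0; rewrite (ltn_trans lt_q k0N).
have [a0 Ea0] := @sum_lowest N F x0 i0 i0N F0.
have [a1 Ea1] := @sum_lowest N (G i0) x1 j0 j0N G0.
have [a2 Ea2] := @sum_lowest N (fun k => iota (c i0 j0 k)) x2 k0 k0N H0.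
rewrite -/(F _) => S0; have {S0} : \sum_(i < N) F i * x0 ^+ i = 0 by [].
(* Dividing by the lowest coefficient produces the constant 1 in the innermost factor of
   [collapse]. *)
rewrite Ea0 [F i0]Ea1 [G i0 j0]Ea2 => /(congr1 ( *%R (iota (c i0 j0 k0)^-1))).
rewrite mulr0 => S0; exists i0, j0, k0.
exists (iota (c i0 j0 k0)^-1 * a0), (iota (c i0 j0 k0)^-1 * a1).
exists (iota (c i0 j0 k0)^-1 * a2); rewrite -[RHS]S0.
rewrite [RHS]mulrCA; congr (_ * _); rewrite [RHS]mulrDr;
  congr (_ + _); last by rewrite mulrA.
rewrite [RHS]mulrCA; congr (_ * _); rewrite [RHS]mulrDr;
  congr (_ + _); last by rewrite mulrA.
rewrite [RHS]mulrCA; congr (_ * _); rewrite [RHS]mulrDr;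
  congr (_ + _); last by rewrite mulrA.
by rewrite -rmorphM mulVf // rmorph1.
Qed.

Lemma is_prime_idealX (P : R -> Prop) x m y :
  is_prime_ideal P -> ~ P x -> P (x ^+ m * y) -> P y.
Proof.
move=> [_ _ _ Pp] nPx; elim: m => [|m IHm]; first by rewrite expr0 mul1r.
by rewrite exprS -mulrA => /Pp[].
Qed.

Lemma prime_chain_collapse n (C : nat -> R -> Prop) :
  (forall x0 x1 x2, collapse x0 x1 x2) -> prime_chain n C -> (n <= 2)%N.
Proof.
move=> col [Cp Cs]; rewrite leqNgt; apply/negP=> lt2n.
have le3 i : (i <= 3)%N -> is_prime_ideal (C i).
  by move=> le_i; apply: Cp; apply: leq_trans lt2n.
have [s0 [x0 [C1x0 nC0x0]]] := Cs 0%N (ltn_trans (ltn0Sn 1) lt2n).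
have [s1 [x1 [C2x1 nC1x1]]] := Cs 1%N (ltn_trans (ltnSn 1) lt2n).
have [s2 [x2 [C3x2 nC2x2]]] := Cs 2%N lt2n.
have [m0 [m1 [m2 [a0 [a1 [a2 E]]]]]] := col x0 x1 x2.
have sub i x y a : (i <= 3)%N -> C i x -> C i (y + a * x) -> C i y.
  move=> le_i Cx Cyx; have [_ CD CM _] := le3 i le_i.
  rewrite -[y](addrK (a * x)) -mulNr; apply: CD => //; exact: CM.
have h0 : C 0%N (x1 ^+ m1 * (x2 ^+ m2 * (1 + a2 * x2) + a1 * x1) + a0 * x0).
  have p0 := le3 0%N isT; apply: (is_prime_idealX (m := m0) p0 nC0x0).
  by rewrite E; case: p0 => -[].
have h1 := sub 1%N _ _ _ isT C1x0 (s0 _ h0).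
have h2 := sub 2%N _ _ _ isT C2x1 (s1 _ (is_prime_idealX (le3 1%N isT) nC1x1 h1)).
have h3 := sub 3%N _ _ _ isT C3x2 (s2 _ (is_prime_idealX (le3 2%N isT) nC2x2 h2)).
by case: (le3 3%N isT) => -[].
Qed.

Lemma ideal_gen_sub (S S' : R -> Prop) x :
  (forall y, S y -> S' y) -> ideal_gen S x -> ideal_gen S' x.
Proof. by move=> SS' [n [c [s [hs ->]]]]; exists n, c, s; split=> // i; apply: SS'. Qed.

(** The same peeling with [J i], the ideal of the first [i] members: cancelling a power of [x i] is
    regularity modulo [J i], and [x i] lies in [J i.+1]. It ends with 1 in [J 3], against
    properness. *)
Lemma regular_seq_collapse (s : seq R) :
  (forall x0 x1 x2, collapse x0 x1 x2) -> regular_seq s -> (size s <= 2)%N.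
Proof.
move=> col [reg n1]; rewrite leqNgt; apply/negP=> lt2s.
pose x i := nth 0 s i; pose J i := ideal_gen (fun y => y \in take i s).
have [m0 [m1 [m2 [a0 [a1 [a2 E]]]]]] := col (x 0%N) (x 1%N) (x 2%N).
have regX i m y : (i < 3)%N -> J i (x i ^+ m * y) -> J i y.
  move=> lt_i; elim: m => [|m IHm]; first by rewrite expr0 mul1r.
  by rewrite exprS -mulrA => /reg h; apply/IHm/h/(leq_trans lt_i).
have sub i y a : (i < 3)%N -> J i (y + a * x i) -> J i.+1 y.
  move=> lt_i Jy; have lt_is : (i < size s)%N by apply: leq_trans lt2s.
  have tk : take i.+1 s = rcons (take i s) (x i) by rewrite (take_nth 0).
  rewrite -[y](addrK (a * x i)) -mulNr; apply: ideal_genD.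
    by apply: ideal_gen_sub Jy => z zs; rewrite tk mem_rcons inE zs orbT.
  by apply/ideal_genM/ideal_gen_mem; rewrite tk mem_rcons inE eqxx.
have h0 : J 0%N (x 1%N ^+ m1 * (x 2%N ^+ m2 * (1 + a2 * x 2%N) + a1 * x 1%N)
                 + a0 * x 0%N).
  by apply: (regX _ m0) => //; rewrite E; apply: ideal_gen0.
have h1 := regX 1%N _ _ isT (sub 0%N _ _ isT h0).
have h2 := regX 2%N _ _ isT (sub 1%N _ _ isT h1).
have h3 := sub 2%N _ _ isT h2.
by apply: n1; apply: ideal_gen_sub h3 => z; apply: mem_take.
Qed.

End Collapse.

(** * The map from K[z1, .., z4] to the fiber cone *)

Lemma ideal_gen_mul (R : comPzRingType) (S S' S'' : R -> Prop) u v :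
  (forall s s', S s -> S' s' -> S'' (s * s')) ->
  ideal_gen S u -> ideal_gen S' v -> ideal_gen S'' (u * v).
Proof.
move=> SS [n [d [s [hs ->]]]] [n' [d' [s' [hs' ->]]]].
rewrite mulr_suml; apply: ideal_gen_sum => i; rewrite -mulrA; apply: ideal_genM.
rewrite mulr_sumr; apply: ideal_gen_sum => j; rewrite mulrCA; apply: ideal_genM.
exact/ideal_gen_mem/SS.
Qed.

Lemma ideal_gen_trans (R : comPzRingType) (S S' : R -> Prop) x :
  (forall y, S y -> ideal_gen S' y) -> ideal_gen S x -> ideal_gen S' x.
Proof.
move=> SS' [n [d [s [hs ->]]]]; apply: ideal_gen_sum => i.
exact/ideal_genM/SS'.
Qed.

Section FiberMap.
Variables (K : fieldType) (a b c : nat).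
Local Notation S := {mpoly K[4]}.
Local Notation A := {mpoly K[2]}.
Local Notation I := (@monI K a b c).
Local Notation m := (@max_ideal K).
Local Notation F := (fiberF K a b c).

Definition expo2 (i j : nat) : 'X_{1..2} :=
  (U_(inord 0) *+ i + U_(inord 1) *+ j)%MM.

Definition gexp : 4.-tuple 'X_{1..2} :=
  [tuple expo2 c 0; expo2 b a; expo2 a b; expo2 0 c].

(** The exponent in K[x, y] of the product of generators of I that corresponds to the monomial
    z^alpha. *)
Definition expo (alpha : 'X_{1..4}) : 'X_{1..2} :=
  (\sum_(i < 4) tnth gexp i *+ alpha i)%MM.

Lemma mpolyX_expo2 i j :
  'X_[expo2 i j] = 'X_(inord 0) ^+ i * 'X_(inord 1) ^+ j :> A.
Proof. by rewrite mpolyXD !mpolyXn. Qed.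

Lemma tnth_gens i : tnth (gens K a b c) i = 'X_[tnth gexp i].
Proof.
case: i => [[|[|[|[|//]]]] ?]; rewrite !(tnth_nth 0%MM) !(tnth_nth 0) /=;
by rewrite mpolyX_expo2 ?expr0 ?mulr1 ?mul1r.
Qed.

Lemma expoD alpha beta : expo (alpha + beta) = (expo alpha + expo beta)%MM.
Proof.
rewrite /expo -big_split; apply: eq_bigr => i _.
by apply/mnmP=> j; rewrite mnmDE !mulmnE mnmDE mulnDr !mulmnE.
Qed.

Lemma expo0 : expo 0 = 0%MM.
Proof. by rewrite /expo big1 // => i _; rewrite mnm0E. Qed.

Lemma expoU i : expo U_(i) = tnth gexp i.
Proof.
rewrite /expo (bigD1 i) //= mnm1E eqxx big1 ?addm0 // => j.
by rewrite eq_sym => /negbTE ij; rewrite mnm1E ij.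
Qed.

Definition rees_map : S -> rees I :=
  mmap (GRing.in_alg (rees I)) (fun i => rees_mon (gens_mem K a b c i)).

HB.instance Definition _ := GRing.RMorphism.on rees_map.

Definition fiber_map (p : S) : F := quotient_proj _ (rees_map p).

Fact fiber_map_zmod : zmod_morphism fiber_map.
Proof. by move=> p q; rewrite /fiber_map !rmorphB. Qed.

Fact fiber_map_monoid : monoid_morphism fiber_map.
Proof. by split=> [|p q]; rewrite /fiber_map ?rmorph1 ?rmorphM. Qed.

HB.instance Definition _ := GRing.isZmodMorphism.Build S F fiber_map fiber_map_zmod.
HB.instance Definition _ :=
  GRing.isMonoidMorphism.Build S F fiber_map fiber_map_monoid.

Lemma rees_mapZ k p : rees_map (k *: p) = k *: rees_map p.
Proof. by rewrite /rees_map mmapZ /= mulr_algl. Qed.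

Lemma fiber_mapZ k p : fiber_map (k *: p) = k *: fiber_map p.
Proof.
rewrite /fiber_map rees_mapZ -mulr_algl rmorphM; congr (_ * _).
Qed.

Lemma fiber_mapX i : fiber_map 'X_i = fiberF_gen K a b c i.
Proof. by rewrite /fiber_map /rees_map mmapX mmap1U. Qed.

Lemma rees_val_map alpha :
  rees_val (rees_map 'X_[alpha]) = 'X_[expo alpha] *: 'X^(mdeg alpha).
Proof.
rewrite /rees_map mmapX /mmap1 -[rees_val _]/(\val _) rmorph_prod /=.
rewrite mdegE /expo; elim/big_rec3: _ => [|i u e d _ ->].
  by rewrite mpolyX0 expr0 scale1r.
rewrite -[rees_val (_ ^+ _)]/(\val _) rmorphXn /= exprZn expr1 mpolyXD exprD -mpolyXn
  tnth_gens.
by rewrite -scalerAl -scalerAr scalerA.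
Qed.

Lemma rees_val_mapE p :
  rees_val (rees_map p) =
  \sum_(al <- msupp p) (p@_al *: 'X_[expo al]) *: 'X^(mdeg al).
Proof.
rewrite {1}[p]mpolyE raddf_sum -[rees_val _]/(\val _) raddf_sum.
apply: eq_bigr => al _; rewrite /= rees_mapZ rees_scaleE rees_val_map scalerA.
by rewrite -scalerAl mul1r.
Qed.

Lemma rees_map_coef p k w :
  (rees_val (rees_map p))`_k@_w =
  \sum_(al <- msupp p | (mdeg al == k) && (expo al == w)) p@_al.
Proof.
rewrite rees_val_mapE coef_sum raddf_sum [RHS]big_mkcond; apply: eq_bigr => al _.
rewrite coefZ coefXn eq_sym; case: eqP => _ /=; last by rewrite mulr0 mcoeff0.
by rewrite mulr1 mcoeffZ mcoeffX; case: eqP => _; rewrite ?mulr1 ?mulr0.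
Qed.

(** The products of [k] of the four generators, a set of monomial generators of I^k. *)
Definition power_gens (k : nat) (f : A) : Prop :=
  exists2 gamma, mdeg gamma = k & f = 'X_[expo gamma].

Lemma monI_power_gens f : I f -> ideal_gen (power_gens 1) f.
Proof.
apply: ideal_gen_trans => y /tnthP[i ->]; apply: ideal_gen_mem.
by exists U_(i)%MM; rewrite ?mdeg1 // expoU tnth_gens.
Qed.

Lemma ideal_exp_power_gens k f : ideal_exp I k f -> ideal_gen (power_gens k) f.
Proof.
elim: k f => [|k IHk] f /=.
  move=> _; rewrite -[f]mulr1; apply/ideal_genM/ideal_gen_mem.
  by exists 0%MM; rewrite ?mdeg0 // expo0 mpolyX0.
apply: ideal_gen_trans => _ [u [v [/monI_power_gens Iu /IHk Iv ->]]].
apply: ideal_gen_mul Iu Iv => _ _ [al dal ->] [be dbe ->].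
by exists (al + be)%MM; rewrite ?mdegD ?dal ?dbe // expoD mpolyXD.
Qed.

(** The monomial is the coefficient of T^|gamma| in the image of z^gamma, and elements of the Rees
    ring have their k-th coefficient in I^k by definition. *)
Lemma power_gens_ideal_exp gamma : ideal_exp I (mdeg gamma) 'X_[expo gamma].
Proof.
have /asboolP/(_ (mdeg gamma)) := valP (rees_map 'X_[gamma]).
by rewrite /= rees_val_map coefZ coefXn eqxx mulr1.
Qed.

Lemma mcoeff_mulX_notin (p : A) e w : ~~ (e <= w)%MM -> (p * 'X_[e])@_w = 0.
Proof.
move=> new; rewrite mcoeffM big1 // => -[k1 k2] /= /eqP wE.
rewrite mcoeffX; case: eqP => [ek2|_]; last by rewrite mulr0.
by case/negP: new; rewrite wE ek2 lem_addl.
Qed.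

(** The ideal m I^k is generated by the monomials that are a variable times a product of [k]
    generators. None of them divides x^w, since a product of generators dividing x^w already equals
    it. *)
Lemma mul_max_coef k w f u :
  (forall gamma, mdeg gamma = k -> (expo gamma <= w)%MM -> expo gamma = w) ->
  ideal_exp I k f -> m u -> (f * u)@_w = 0.
Proof.
move=> wmin /ideal_exp_power_gens If mu.
have : ideal_gen (fun x => exists2 al, mdeg al = k &
    exists i, x = 'X_[expo al + U_(i)] :> A) (f * u).
  apply: ideal_gen_mul If mu => _ s' [al dal ->]; rewrite !inE.
  by case/orP=> /eqP ->; exists al => //;
     [exists (inord 0)|exists (inord 1)]; rewrite mpolyXD.
case=> n [d [s [hs ->]]]; rewrite raddf_sum big1 // => j _ /=.
have [al dal [i ->]] := hs j; apply: mcoeff_mulX_notin; apply/negP=> le_w.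
have := wmin _ dal (lepm_trans (lem_addr _ _) le_w) => expw.
by move/mnm_lepP/(_ i): le_w; rewrite expw mnmDE mnm1E eqxx addn1 ltnn.
Qed.

(** This provides the linear functionals that detect nonzero classes in F(I): the coefficient at a
    minimal [w] in T^k vanishes on m R(I). *)
Lemma rees_extend_coef q k w :
  (forall gamma, mdeg gamma = k -> (expo gamma <= w)%MM -> expo gamma = w) ->
  ideal_gen (@rees_extend _ _ m I) q -> (rees_val q)`_k@_w = 0.
Proof.
move=> wmin [n [d [s [hs ->]]]].
rewrite -[rees_val _]/(\val _) raddf_sum /= coef_sum raddf_sum big1 // => i _.
have [u mu su] := hs i;
  rewrite -[LHS]/((rees_val (d i * s i))`_k@_w) rees_valM su coefMC.
by apply: (mul_max_coef wmin) => //; have /asboolP/(_ k) := valP (d i).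
Qed.

Lemma max_idealX e : e != 0%MM -> m 'X_[e].
Proof.
move=> e0; have [i ei] : exists i, e i != 0%N.
  apply: contra_notP (negP e0) => /forallNP h; apply/eqP/mnmP=> i.
  by rewrite mnm0E; apply: contra_notP (h i) => /eqP.
rewrite -[e](submK (m := U_(i)%MM)) ?lep1mP // mpolyXD.
apply/ideal_genM/ideal_gen_mem; rewrite !inE.
by case: i {ei} => -[|[|//]] ?; apply/orP; [left|right]; apply/eqP;
   congr 'X_(_); apply: val_inj; rewrite /= inordK.
Qed.

Lemma max_ideal_subC p : m (p - (p@_0)%:MP).
Proof.
rewrite {1}[p]mpolyE; case: (boolP (0%MM \in msupp p)) => p0.
  rewrite (bigD1_seq 0%MM) ?msupp_uniq //= mpolyX0 alg_mpolyC addrAC subrr add0r.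
  elim/big_ind: _ => [||al al0]; [exact: ideal_gen0|exact: ideal_genD|].
  by rewrite -mul_mpolyC; apply/ideal_genM/max_idealX.
rewrite memN_msupp_eq0 // mpolyC0 subr0 big_seq.
elim/big_ind: _ => [||al alp]; [exact: ideal_gen0|exact: ideal_genD|].
rewrite -mul_mpolyC; apply/ideal_genM/max_idealX.
by apply: contraNneq p0 => <-.
Qed.

Lemma fiber_map_eq0 p :
  fiber_map p = 0 <-> ideal_gen (@rees_extend _ _ m I) (rees_map p).
Proof. by rewrite -(rmorph0 (quotient_proj _)) quotient_proj_eq subr0. Qed.

(** In the Rees ring the image of z^alpha is that of z^gamma times a monomial ['X_[e]] of degree 0
    in T. As [e] is nonzero, this monomial lies in m. *)
Lemma fiber_mapX_eq0 alpha gamma :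
  mdeg gamma = mdeg alpha -> (expo gamma <= expo alpha)%MM ->
  expo gamma != expo alpha -> fiber_map 'X_[alpha] = 0.
Proof.
move=> dga lega nega; apply/fiber_map_eq0.
pose e := (expo alpha - expo gamma)%MM.
have e0 : e != 0%MM.
  by apply: contraNneq nega => e0; rewrite -[expo alpha](submK lega) -/e e0 add0m.
have -> : rees_map 'X_[alpha] =
    rees_map 'X_[gamma] * @rees_mon _ _ I 0 'X_[e] Logic.I.
  apply: rees_val_inj; rewrite rees_valM !rees_val_map /= expr0.
  by rewrite -scalerAr mulr1 scalerA -mpolyXD submK // dga.
apply/ideal_genM/ideal_gen_mem; exists 'X_[e]; first exact: max_idealX.
by rewrite /= expr0 alg_polyC.
Qed.

(** By minimality [alpha] is the only exponent of its degree that maps to [expo alpha]. Hence the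
    functional of [rees_extend_coef], composed with [rees_map], reads off exactly the coefficient of
    z^alpha. *)
Lemma fiber_map_coef p alpha :
  (forall gamma, mdeg gamma = mdeg alpha -> (expo gamma <= expo alpha)%MM ->
     gamma = alpha) ->
  fiber_map p = 0 -> p@_alpha = 0.
Proof.
move=> amin /fiber_map_eq0 /(rees_extend_coef (k := mdeg alpha) (w := expo alpha)).
rewrite rees_map_coef => h.
rewrite -[RHS]h; last by move=> gamma dg le_g; rewrite (amin gamma).
have eqa al : (mdeg al == mdeg alpha) && (expo al == expo alpha) = (al == alpha).
  apply/andP/eqP=> [[/eqP da /eqP ea]|->]; last by rewrite !eqxx.
  by apply: amin => //; rewrite ea lepm_refl.
rewrite (eq_bigl _ _ eqa); case: (boolP (alpha \in msupp p)) => ap.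
  by rewrite -big_filter filter_pred1_uniq ?msupp_uniq // big_seq1.
rewrite memN_msupp_eq0 // big_seq_cond big1 // => al /andP[alp /eqP ea].
by rewrite -ea alp in ap.
Qed.

(** Writing [f] in terms of products of [k] generators, each coefficient [d i] may be replaced
    modulo m by its constant term. What remains is the image of a form of degree [k]. *)
Lemma fiber_class_map k f (hf : ideal_exp I k f) :
  exists2 p : S, (forall al, al \in msupp p -> mdeg al = k) &
    fiber_class m hf = fiber_map p.
Proof.
have [n [d [s [hs fE]]]] := ideal_exp_power_gens hf.
have /choice[ga gaE] : forall i, exists ga, mdeg ga = k /\ s i = 'X_[expo ga].
  by move=> i; have [ga dg ->] := hs i; exists ga.
exists (\sum_i (d i)@_0 *: 'X_[ga i]).
  move=> al; apply: contraTeq => dal; rewrite -mcoeff_eq0 raddf_sum big1 // => i _.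
  rewrite /= mcoeffZ mcoeffX; case: eqP => [gal|_]; last by rewrite mulr0.
  by rewrite -gal (gaE i).1 eqxx in dal.
have val_sum (G : 'I_n -> rees I) : rees_val (\sum_i G i) = \sum_i rees_val (G i).
  exact: (raddf_sum (\val : rees I -> {poly A})).
rewrite /fiber_class;
  have -> : rees_mon hf = \sum_i @rees_mon _ _ I 0 (d i) Logic.I * rees_map 'X_[ga i].
  apply: rees_val_inj; rewrite val_sum /= fE scaler_suml; apply: eq_bigr => i _.
  have [dg ->] := gaE i; rewrite rees_val_map dg /= expr0 -scalerAl.
  by rewrite mul1r scalerA.
rewrite !rmorph_sum; apply: eq_bigr => i _; rewrite rmorphM /= fiber_mapZ.
congr (_ * _); apply/quotient_proj_eq/ideal_gen_mem.
exists (d i - ((d i)@_0)%:MP); first exact: max_ideal_subC.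
rewrite -[LHS]/(rees_val _ - rees_val _) rees_scaleE /= expr0 alg_polyC.
by rewrite alg_polyC alg_mpolyC polyCB.
Qed.

Lemma fiber_map_surj y : exists p, y = fiber_map p.
Proof.
rewrite -[y]quotient_reprK; set q := quotient_repr y.
have /asboolP Iq := valP q.
(* A Rees element is the sum of its T-homogeneous components, to which [fiber_class_map] applies. *)
have -> : q = \sum_(k < size (rees_val q)) rees_mon (Iq k).
  apply: rees_val_inj; rewrite -[RHS]/(\val _) raddf_sum /= -[LHS]coefK.
  by rewrite poly_def.
rewrite rmorph_sum; elim/big_ind: _ => [|_ _ [p ->] [r ->]|k _].
- by exists 0; rewrite rmorph0.
- by exists (p + r); rewrite rmorphD.
- by have [p _ h] := fiber_class_map (Iq k); exists p; rewrite -h.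
Qed.

Lemma fiber_compP k y :
  fiberF_comp k y <->
  exists2 p : S, (forall al, al \in msupp p -> mdeg al = k) & y = fiber_map p.
Proof.
split=> [[f [hf ->]]|[p dp ->]].
  by have [p dp ->] := fiber_class_map hf; exists p.
have hf : ideal_exp I k (\sum_(al <- msupp p) p@_al *: 'X_[expo al]).
  rewrite big_seq; elim/big_ind: _ => [||al /dp <-].
  - exact: ideal_exp0.
  - exact: ideal_expD.
  - by rewrite -mul_mpolyC; apply/ideal_expM/power_gens_ideal_exp.
exists _, hf; congr quotient_proj; apply: rees_val_inj.
rewrite rees_val_mapE /= scaler_suml big_seq [RHS]big_seq.
by apply: eq_bigr => al /dp ->.
Qed.

End FiberMap.

(** * Monomial bases of the fiber cone *)

(* Labels of a module basis with one element of degree 0 and two elements in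
   each degree from 1 to [q]. *)
Definition label (q : nat) : finType := (unit + ('I_q + 'I_q))%type.

Definition label_deg q (e : label q) : nat :=
  match e with inl _ => 0 | inr (inl l) => l.+1 | inr (inr l) => l.+1 end.

Lemma sum_label_deg q k :
  (\sum_(e : label q) (k.+1 - label_deg e) = k.+1 + 2 * \sum_(l < q) (k - l))%N.
Proof.
rewrite big_sumType /= big_sumType /= big_const card_unit /= subn0 addn0.
by rewrite mul2n -addnn; congr (_ + (_ + _))%N; apply: eq_bigr => l _; rewrite subSS.
Qed.

Section MonomialBasis.
Variables (K : fieldType) (a b c q : nat).
Local Notation S := {mpoly K[4]}.
Local Notation F := (fiberF K a b c).
Local Notation f := (@fiber_map K a b c).
Local Notation ex := (expo a b c).
Variable nu : nat * nat * label q -> 'X_{1..4}.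

Definition index_deg (x : nat * nat * label q) : nat :=
  (x.1.1 + x.1.2 + label_deg x.2)%N.

(** The combinatorial input that each case must supply. [nu] enumerates the normal monomials; the
    third condition makes their images minimal among all products of the same degree, the fourth
    makes every other monomial vanish in F(I). *)
Definition basis_exponents : Prop :=
  [/\ injective nu, forall x, mdeg (nu x) = index_deg x,
      forall gamma x, mdeg gamma = mdeg (nu x) ->
        (ex gamma <= ex (nu x))%MM -> gamma = nu x &
      forall gamma, (exists x, gamma = nu x) \/
        exists gamma', [/\ mdeg gamma' = mdeg gamma, (ex gamma' <= ex gamma)%MM &
          ex gamma' != ex gamma]].

Hypothesis nuP : basis_exponents.

Let nu_inj : injective nu. Proof. by case: nuP. Qed.
Let nu_deg x : mdeg (nu x) = index_deg x. Proof. by case: nuP. Qed.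
Let nu_min gamma x :
  mdeg gamma = mdeg (nu x) -> (ex gamma <= ex (nu x))%MM -> gamma = nu x.
Proof. by case: nuP => _ _ h _; apply: h. Qed.

Lemma fiber_map_notin gamma : ~ (exists x, gamma = nu x) -> f 'X_[gamma] = 0.
Proof.
case: nuP => _ _ _ /(_ gamma)[//|[g' [dg le_g ne_g]]] _.
exact: fiber_mapX_eq0 dg le_g ne_g.
Qed.

Lemma fiber_monomials_free (T : finType) (h : T -> nat * nat * label q) :
  injective h -> lin_free (fun t => f 'X_[nu (h t)]).
Proof.
move=> h_inj d; under eq_bigr do rewrite -fiber_mapZ.
rewrite -rmorph_sum => d0 t.
rewrite -[RHS](fiber_map_coef (alpha := nu (h t)) _ d0); last by move=> ga;
  exact: nu_min.
rewrite raddf_sum (bigD1 t) //= mcoeffZ mcoeffX eqxx mulr1 big1 ?addr0 // => u ut.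
by rewrite mcoeffZ mcoeffX (inj_eq nu_inj) (inj_eq h_inj) (negbTE ut) mulr0.
Qed.

Lemma fiber_map_in_span (T : finType) (h : T -> nat * nat * label q) p :
  (forall x, nu x \in msupp p -> exists t, h t = x) ->
  in_span (fun t => f 'X_[nu (h t)]) (f p).
Proof.
move=> hp; rewrite [p]mpolyE raddf_sum big_seq; apply: in_span_sum => al alp.
rewrite /= fiber_mapZ; apply: in_spanZ.
have [[x alx]|nal] := pselect (exists x, al = nu x).
  rewrite alx in alp *; have [t <-] := hp x alp.
  exact: (in_span_mem (fun t => f 'X_[nu (h t)])).
by rewrite fiber_map_notin //; apply: in_span0.
Qed.

(** Indices of total degree [k]: a label and the first exponent, the second being determined by the
    degree. Truncated subtraction leaves no index for labels of degree above [k]. *)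
Definition comp_index k : finType := {e : label q & 'I_(k.+1 - label_deg e)}.

Lemma card_comp_index k :
  #|comp_index k| = (k.+1 + 2 * \sum_(l < q) (k - l))%N.
Proof.
rewrite card_tagged sumnE big_map big_enum /= -sum_label_deg.
by apply: eq_bigr => e _; rewrite card_ord.
Qed.

Lemma fiber_has_dim :
  is_hilbert_series (@fiberF_comp K a b c)
    (fun k => k.+1 + 2 * \sum_(l < q) (k - l))%N.
Proof.
move=> k; rewrite -card_comp_index.
pose h (t : comp_index k) : nat * nat * label q :=
  (nat_of_ord (tagged t), (k - label_deg (tag t) - tagged t)%N, tag t).
have degh t : index_deg (h t) = k.
  by case: t => e s; rewrite /h /index_deg /=; have := ltn_ord s; lia.
apply: (lin_free_has_dim (v := fun t => f 'X_[nu (h t)])).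
  apply: fiber_monomials_free => -[e s] [e' s'] [/= ss _ ee].
  by subst e'; congr existT; apply: val_inj.
move=> y; rewrite fiber_compP; split=> [[p dp ->]|[d ->]].
  apply: fiber_map_in_span => -[[s t] e] /dp; rewrite nu_deg /index_deg /= => dk.
  have sk : (s < k.+1 - label_deg e)%N by lia.
  exists (existT _ e (Ordinal sk)); rewrite /h /=; congr (_, _, _); lia.
exists (\sum_t d t *: 'X_[nu (h t)]); last first.
  by rewrite raddf_sum; apply: eq_bigr => t _; rewrite /= fiber_mapZ.
move=> al; apply: contraTeq => dal; rewrite -mcoeff_eq0 raddf_sum big1 // => t _.
rewrite /= mcoeffZ mcoeffX; case: eqP => [tal|_]; last by rewrite mulr0.
by rewrite -tal nu_deg degh eqxx in dal.
Qed.

Section Presentation.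
Variable J : seq S.
Hypothesis J0 : forall p, p \in J -> f p = 0.
Hypothesis JX : forall gamma,
  ~ (exists x, gamma = nu x) -> ideal_gen (fun p => p \in J) 'X_[gamma].

(** In a polynomial of the kernel the normal monomials have coefficient zero by [fiber_map_coef],
    and all other monomials lie in (J) by [JX]. *)
Lemma fiber_map_ker p : f p = 0 <-> ideal_gen (fun p => p \in J) p.
Proof.
split=> [fp0|[n [d [s [hs ->]]]]]; last first.
  by rewrite rmorph_sum big1 // => i _; rewrite rmorphM /= (J0 (hs i)) mulr0.
rewrite [p]mpolyE; elim/big_ind: _ => [||al _].
- exact: ideal_gen0.
- exact: ideal_genD.
have [[x ->]|nal] := pselect (exists x, al = nu x).
  rewrite (fiber_map_coef _ fp0) ?scale0r; [exact: ideal_gen0|by move=> ga;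
    exact: nu_min].
by rewrite -mul_mpolyC; apply/ideal_genM/JX.
Qed.

Definition presentation (y : quotient_ring (fun p => p \in J)) : F :=
  f (quotient_repr y).

Lemma presentation_proj p : presentation (quotient_proj _ p) = f p.
Proof.
apply/eqP; rewrite -subr_eq0 -rmorphB; apply/eqP/fiber_map_ker.
by apply/quotient_proj_eq; rewrite quotient_reprK.
Qed.

Fact presentation_zmod : zmod_morphism presentation.
Proof.
move=> y z; rewrite -[y]quotient_reprK -[z]quotient_reprK -rmorphB.
by rewrite !presentation_proj rmorphB.
Qed.

Fact presentation_monoid : monoid_morphism presentation.
Proof.
split=> [|y z]; first by rewrite -(rmorph1 (quotient_proj _)) presentation_proj rmorph1.
rewrite -[y]quotient_reprK -[z]quotient_reprK -rmorphM.
by rewrite !presentation_proj rmorphM.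
Qed.

Lemma fiber_presented : fiberF_presented_by a b c J.
Proof.
pose mz := GRing.isZmodMorphism.Build _ _ presentation presentation_zmod.
pose mm := GRing.isMonoidMorphism.Build _ _ presentation presentation_monoid.
pose phi : {rmorphism quotient_ring (fun p => p \in J) -> F} :=
  HB.pack presentation mz mm.
exists phi; split=> [k y||i].
- rewrite -[y]quotient_reprK; set p := quotient_repr y.
  have -> : k *: quotient_proj (fun p => p \in J) p = quotient_proj _ (k *: p).
    by rewrite -[k *: p]mulr_algl rmorphM.
  by rewrite /= !presentation_proj fiber_mapZ.
- exists (fun z => quotient_proj _ (projT1 (cid (fiber_map_surj z)))) => [y|z] /=.
    case: cid => p /= yp; rewrite -[y]quotient_reprK; apply/quotient_proj_eq.
    by apply/fiber_map_ker; rewrite rmorphB /= -yp subrr.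
  by case: cid => p /= ->; rewrite presentation_proj.
- by rewrite /= presentation_proj fiber_mapX.
Qed.

End Presentation.

Lemma msizeX_le (p : S) d i : (msize p <= d)%N -> (msize (p ^+ i) <= i * d.+1 + 1)%N.
Proof.
move=> pd; elim: i => [|i IHi]; first by rewrite expr0 msize1.
by rewrite exprS; apply: leq_trans (msizeM_le _ _) _; lia.
Qed.

Lemma fiber_scaleE k (y : F) : k *: y = f k%:MP * y.
Proof. by have [p ->] := fiber_map_surj y; rewrite -fiber_mapZ -rmorphM mul_mpolyC. Qed.

(** With N = m^2 k + 1 and n = N m this reads n^2 k < N^3, as m^2 k < N. In [fiber_collapse] the
    left side bounds a spanning family and the right side counts the monomials in a box. *)
Lemma box_arith m k :
  ((m * m * k).+1 * m * ((m * m * k).+1 * m) * k <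
     (m * m * k).+1 * (m * m * k).+1 * (m * m * k).+1)%N.
Proof.
have -> x : (x * m * (x * m) * k = x * x * (m * m * k))%N by nia.
by rewrite ltn_pmul2l.
Qed.

Lemma fiber_collapse (x0 x1 x2 : F) : collapse x0 x1 x2.
Proof.
have [p0 Ep0] := fiber_map_surj x0; have [p1 Ep1] := fiber_map_surj x1.
have [p2 Ep2] := fiber_map_surj x2.
(* A product of powers of [p0], [p1], [p2] with exponents at most [N'] has size at most 3N'(d + 1) +
   5, and M = 3d + 8 makes n = N M reach this bound. The factor 1 + (q + q) is the number of
   labels. *)
pose d := (msize p0 + msize p1 + msize p2)%N; pose M := (3 * d + 8)%N.
pose N' := (M * M * (1 + (q + q)))%N; pose N := N'.+1; pose n := (N * M)%N.
pose v (t : 'I_n * 'I_n * label q) := f 'X_[nu (val t.1.1, val t.1.2, t.2)].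
pose u (t : 'I_N * 'I_N * 'I_N) := x0 ^+ t.1.1 * x1 ^+ t.1.2 * x2 ^+ t.2.
have uv t : in_span v (u t).
  case: t => [[i j] k]; rewrite /u Ep0 Ep1 Ep2 -!rmorphXn -!rmorphM /=.
  apply: (fiber_map_in_span
    (h := fun t : 'I_n * 'I_n * label q => (val t.1.1, val t.1.2, t.2))).
  case=> -[s t] e /msize_mdeg_lt; rewrite nu_deg /index_deg /= => lt_deg.
  have lt_n : (s + t + label_deg e < n)%N.
    apply: leq_trans lt_deg _.
    have h0 := @msizeX_le p0 d i ltac:(rewrite /d; lia).
    have h1 := @msizeX_le p1 d j ltac:(rewrite /d; lia).
    have h2 := @msizeX_le p2 d k ltac:(rewrite /d; lia).
    have h3 := msizeM_le (p0 ^+ i) (p1 ^+ j).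
    have h4 := msizeM_le (p0 ^+ i * p1 ^+ j) (p2 ^+ k).
    have ijk : (i + j + k <= 3 * N')%N.
      by have := ltn_ord i; have := ltn_ord j; have := ltn_ord k; rewrite /N; lia.
    have := leq_mul ijk (leqnn d.+1); rewrite !mulnDl => le_ijk.
    apply: leq_trans (_ : 3 * N' * d.+1 + 5 <= n)%N; first by lia.
    have arith x y : (3 * x * y.+1 + 5 <= x.+1 * (3 * y + 8))%N by nia.
    exact: arith.
  have sn : (s < n)%N by lia.
  have tn : (t < n)%N by lia.
  by exists (Ordinal sn, Ordinal tn, e).
(* Freeness would force N^3 <= n^2 (2q + 1), contrary to [box_arith]. *)
have /existsNP[d' /not_implyP[d0 /existsNP[[[i1 j1] k1] d1]]] : ~ lin_free u.
  move=> /lin_free_card /(_ uv); rewrite !card_prod !card_sum card_unit !card_ord.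
  by apply/negP; rewrite -ltnNge /n /N /N'; apply: box_arith.
apply: (@dependent_collapse F K (f \o @mpolyC 4 K) N
  (fun i j k => d' (inord i, inord j, inord k))).
  by exists i1, j1, k1; split; rewrite ?ltn_ord // !inord_val; apply/eqP.
have {d0}d0 : \sum_i \sum_j \sum_k d' (i, j, k) *: u (i, j, k) = 0.
  rewrite -[RHS]d0 pair_bigA pair_bigA.
  by apply: eq_bigr => -[[i j] k].
rewrite -[RHS]d0; apply: eq_bigr => i _; rewrite mulr_suml; apply: eq_bigr => j _.
rewrite !mulr_suml; apply: eq_bigr => k _; rewrite !inord_val fiber_scaleE /u /=.
by rewrite -!mulrA; congr (_ * _); rewrite mulrA [RHS]mulrC; congr (_ * _);
  rewrite mulrC.
Qed.

End MonomialBasis.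

(** * Cohen-Macaulayness from a pair of parameters *)

Section ZeroVariables.
Variables (K : fieldType) (n : nat).
Local Notation S := {mpoly K[n]}.

Definition zero_vars (Z : pred 'I_n) : S -> S :=
  comp_mpoly [tuple (if Z i then 0 else 'X_i : S) | i < n].

HB.instance Definition _ Z := GRing.RMorphism.on (zero_vars Z).

Lemma zero_varsX Z i : zero_vars Z 'X_i = if Z i then 0 else 'X_i.
Proof. by rewrite /zero_vars comp_mpolyXU -tnth_nth tnth_mktuple. Qed.

Lemma zero_varsC Z k : zero_vars Z k%:MP = k%:MP.
Proof. exact: comp_mpolyC. Qed.

Lemma zero_vars_comp (Z Z' : pred 'I_n) p :
  (forall i, Z i -> Z' i) -> zero_vars Z' (zero_vars Z p) = zero_vars Z' p.
Proof.
move=> ZZ'; rewrite [p]mpolyE (rmorph_sum (zero_vars Z)) !rmorph_sum;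
  apply: eq_bigr => al _ /=.
rewrite -mul_mpolyC !rmorphM /= !zero_varsC; congr (_ * _).
rewrite mpolyXE_id (rmorph_prod (zero_vars Z)) !rmorph_prod; apply: eq_bigr => i _ /=.
rewrite !rmorphXn /=; congr (_ ^+ _); rewrite !zero_varsX.
by case Zi: (Z i); rewrite ?rmorph0 ?zero_varsX // ZZ'.
Qed.

End ZeroVariables.

Section CohenMacaulay.
Variables (K : fieldType) (a b c q : nat).
Local Notation S := {mpoly K[4]}.
Local Notation F := (fiberF K a b c).
Local Notation f := (@fiber_map K a b c).

(** The image in F(I) of the ideal generated by the variables in [Z]. *)
Definition zero_vars_prime (Z : pred 'I_4) (y : F) : Prop :=
  exists2 p, zero_vars Z p = 0 & y = f p.

Section Primes.
Variable Z : pred 'I_4.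
Hypothesis kerZ : forall p, f p = 0 -> zero_vars Z p = 0.

Lemma zero_vars_primeE p : zero_vars_prime Z (f p) <-> zero_vars Z p = 0.
Proof.
split=> [[r r0 pr]|p0]; last by exists p.
by rewrite -[p](subrK r) rmorphD /= r0 addr0 kerZ // rmorphB /= pr subrr.
Qed.

(** By [kerZ] the substitution factors through F(I), and its values lie in a polynomial ring, which
    is a domain. *)
Lemma zero_vars_primeP : is_prime_ideal (zero_vars_prime Z).
Proof.
split=> [|y z [p p0 ->] [r r0 ->]|y z [p p0 ->]|y z].
- split; first by exists 0; rewrite ?rmorph0.
  rewrite -(rmorph1 f) => /zero_vars_primeE /eqP.
  by rewrite rmorph1 oner_eq0.
- by exists (p + r); rewrite rmorphD //= p0 r0 addr0.
- have [r ->] := fiber_map_surj y.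
  by exists (r * p); rewrite rmorphM //= p0 mulr0.
- have [p ->] := fiber_map_surj y; have [r ->] := fiber_map_surj z.
  rewrite -rmorphM => /zero_vars_primeE /eqP.
  rewrite rmorphM mulf_eq0 => /orP[]/eqP h; [left|right];
  exact/zero_vars_primeE.
Qed.

End Primes.

(** The chain kills [Z0], then also z_i, then all variables. The classes of z_i and z_j witness that
    the two inclusions are strict. *)
Lemma zero_vars_chain (Z0 : pred 'I_4) (i j : 'I_4) :
  (forall p, f p = 0 -> zero_vars Z0 p = 0) -> ~~ Z0 i -> ~~ Z0 j -> i != j ->
  exists C : nat -> F -> Prop, prime_chain 2 C.
Proof.
move=> ker0 nZi nZj ij; pose Z1 : pred 'I_4 := fun l => (l == i) || Z0 l.
pose Z (k : nat) : pred 'I_4 := if k is k'.+1 then if k' is 0 then Z1 else predT else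
  Z0.
have Z0Z k l : Z0 l -> Z k l by case: k => [|[|k]] //= h; rewrite /Z1 h orbT.
have kerZ k p : f p = 0 -> zero_vars (Z k) p = 0.
  by move=> /ker0 p0; rewrite -(zero_vars_comp (Z := Z0) p (Z0Z k)) p0 rmorph0.
have step k l : (forall m, Z k m -> Z k.+1 m) -> ~~ Z k l -> Z k.+1 l ->
    (forall x, zero_vars_prime (Z k) x -> zero_vars_prime (Z k.+1) x) /\
    exists x, zero_vars_prime (Z k.+1) x /\ ~ zero_vars_prime (Z k) x.
  move=> sub nZl Zl; split=> [x [p p0 ->]|].
    by exists p; rewrite // -(zero_vars_comp p sub) p0 rmorph0.
  exists (f 'X_l); split; first by exists 'X_l; rewrite // zero_varsX Zl.
  move/(zero_vars_primeE (kerZ k)); rewrite zero_varsX (negbTE nZl) => X0.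
  by have := msizeX K U_(l)%MM; rewrite X0 mmeasure0.
exists (fun k => zero_vars_prime (Z k)); split=> [k _|[|[|//]] _].
- exact/zero_vars_primeP/kerZ.
- by apply: (step 0%N i) => // [m|] /=; [exact: (Z0Z 1%N)|rewrite /Z1 eqxx].
- apply: (step 1%N j) => //=.
  by rewrite /Z1 negb_or eq_sym ij.
Qed.

Variable nu : nat * nat * label q -> 'X_{1..4}.
Hypothesis nuP : basis_exponents a b c nu.

Variables (th1 th2 : S) (bas : label q -> S).

Definition param_basis (x : nat * nat * label q) : F :=
  f (th1 ^+ x.1.1 * th2 ^+ x.1.2 * bas x.2).

(** All indices of degree below [n]; bounding the two exponents by [n] loses none of them and makes
    the type finite. *)
Definition filtered_index n : finType :=
  {x : 'I_n * 'I_n * label q |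
     (index_deg (val x.1.1, val x.1.2, x.2) < n)%N}.

Definition filtered_val n (t : filtered_index n) : nat * nat * label q :=
  (val (val t).1.1, val (val t).1.2, (val t).2).

Lemma filtered_val_inj n : injective (@filtered_val n).
Proof.
move=> [[[s t] e] ?] [[[s' t'] e'] ?] [/= /val_inj es /val_inj et ee].
by apply: val_inj; rewrite /= es et ee.
Qed.

Lemma filtered_valP n x :
  (index_deg x < n)%N -> exists t : filtered_index n, filtered_val t = x.
Proof.
case: x => [[s t] e] lt_n.
have sn : (s < n)%N by apply: leq_ltn_trans lt_n; rewrite /index_deg /=; lia.
have tn : (t < n)%N by apply: leq_ltn_trans lt_n; rewrite /index_deg /=; lia.
by exists (@exist _ (fun x : 'I_n * 'I_n * label q =>
   index_deg (val x.1.1, val x.1.2, x.2) < n)%N (Ordinal sn, Ordinal tn, e) lt_n).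
Qed.

Hypothesis spanP : forall n x, (index_deg x < n)%N ->
  in_span (fun t : filtered_index n => param_basis (filtered_val t)) (f 'X_[nu x]).

(* In filtration degree below [n] the two families have the same finite number
   of members, so the spanning family is free because the other one is. *)
Lemma param_basis_free (T : finType) (h : T -> nat * nat * label q) :
  injective h -> lin_free (fun t => param_basis (h t)).
Proof.
move=> h_inj; pose n := (\max_t index_deg (h t)).+1.
have hn t : (index_deg (h t) < n)%N by rewrite ltnS; apply: leq_bigmax.
have fw : lin_free (fun t : filtered_index n => param_basis (filtered_val t)).
  apply: lin_free_exchange (fiber_monomials_free nuP (@filtered_val_inj n)) _ => t.
  apply: spanP; case: t => [[[s t] e] /= lt_n]; exact: lt_n.
have /choice[g gP] : forall t, exists u : filtered_index n, filtered_val u = h t.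
  by move=> t; apply: filtered_valP.
move=> d d0 t.
pose d' (u : filtered_index n) := \sum_(t | g t == u) d t.
have g_inj : injective g by move=> t1 t2 e12; apply: h_inj; rewrite -!gP e12.
have := fw d' _ (g t).
rewrite {2}/d' (eq_bigl (pred1 t)) => [|t' /=]; last by rewrite (inj_eq g_inj).
rewrite big_pred1_eq; apply; rewrite -[RHS]d0 /d'.
under eq_bigr do rewrite scaler_suml.
rewrite (exchange_big_dep xpredT) //=; apply: eq_bigr => t' _.
by rewrite (eq_bigl (pred1 (g t'))) ?big_pred1_eq ?gP // => u; rewrite eq_sym.
Qed.

Lemma param_basis_span (y : F) : exists n, in_span
  (fun t : 'I_n * 'I_n * label q => param_basis (val t.1.1, val t.1.2, t.2)) y.
Proof.
have [p ->] := fiber_map_surj y; exists (msize p).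
have pv : in_span (fun t : filtered_index (msize p) => f 'X_[nu (filtered_val t)]) (f
  p).
  apply: (fiber_map_in_span nuP) => x /msize_mdeg_lt.
  by case: nuP => _ -> _ _ /filtered_valP.
apply: in_span_trans pv => t.
have tn : (index_deg (filtered_val t) < msize p)%N by case: t.
apply: in_span_trans (spanP tn) => u.
exact: (in_span_mem (fun t : 'I_(msize p) * 'I_(msize p) * label q =>
  param_basis (val t.1.1, val t.1.2, t.2)) (val u)).
Qed.

Lemma fiber_scalerAr k (x y : F) : x * (k *: y) = k *: (x * y).
Proof. by rewrite !fiber_scaleE mulrCA. Qed.

Lemma param_basis_th1 s t e : param_basis (s.+1, t, e) = f th1 * param_basis (s, t, e).
Proof. by rewrite /param_basis -rmorphM /= exprS !mulrA. Qed.

Lemma param_basis_th2 s t e : param_basis (s, t.+1, e) = f th2 * param_basis (s, t, e).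
Proof. by rewrite /param_basis -rmorphM /= exprS mulrCA !mulrA. Qed.

(** Multiplication by [th1] shifts the first exponent, so it carries the free family injectively
    into itself. *)
Lemma param_regular1 (y : F) : f th1 * y = 0 -> y = 0.
Proof.
have [n [d ->]] := param_basis_span y; rewrite mulr_sumr => d0.
pose h (t : 'I_n * 'I_n * label q) := ((val t.1.1).+1, val t.1.2, t.2).
have h_inj : injective h.
  by move=> [[s t] e] [[s' t'] e'] [/= /val_inj -> /val_inj -> ->].
rewrite big1 // => t _; rewrite (param_basis_free h_inj (c := d)) ?scale0r //.
by rewrite -[RHS]d0; apply: eq_bigr => u _; rewrite fiber_scalerAr -param_basis_th1.
Qed.

Lemma param_basis_mod1 (y : F) : exists n (d : 'I_n * label q -> K) z,
  y = \sum_t d t *: param_basis (0%N, val t.1, t.2) + f th1 * z.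
Proof.
have [n yn] := param_basis_span y; exists n.
suff [y0 [d ->] [z ->]] : exists2 y0,
    in_span (fun t : 'I_n * label q => param_basis (0%N, val t.1, t.2)) y0 &
    exists z, y = y0 + f th1 * z by exists d, z.
case: yn => d ->; elim/big_ind: _ => [|_ _ [y0 h0 [z ->]] [y1 h1 [z' ->]]|[[[s ltsn]
  t] e] _].
- by exists 0; [exact: in_span0|exists 0; rewrite mulr0 addr0].
- exists (y0 + y1); first exact: in_spanD.
  by exists (z + z'); rewrite mulrDr addrACA.
case: s ltsn => [|s] ltsn /=.
  exists (d (Ordinal ltsn, t, e) *: param_basis (0%N, val t, e)).
    apply: in_spanZ; exact: (in_span_mem
      (fun t : 'I_n * label q => param_basis (0%N, val t.1, t.2)) (t, e)).
  by exists 0; rewrite mulr0 addr0.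
exists 0; first exact: in_span0.
exists (d (Ordinal ltsn, t, e) *: param_basis (s, val t, e)).
by rewrite add0r fiber_scalerAr -param_basis_th1.
Qed.

(** Modulo [th1], the element [y] is a combination of members with first exponent 0. Multiplied by
    [th2] these still have first exponent 0, while every member on the other side has a positive
    one; freeness over the disjoint union of the two index sets kills the coefficients. *)
Lemma param_regular2 (y z : F) : f th2 * y = f th1 * z -> exists z', y = f th1 * z'.
Proof.
have [n [d [y1 ->]]] := param_basis_mod1 y.
rewrite mulrDr mulrCA => /eqP; rewrite -subr_eq0 -addrA -mulrBr.
have [m [d' ->]] := param_basis_span (f th2 * y1 - z) => /eqP d0.
pose h (t : ('I_n * label q) + ('I_m * 'I_m * label q)) : nat * nat * label q :=
  match t with inl t => (0%N, (val t.1).+1, t.2)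
             | inr t => ((val t.1.1).+1, val t.1.2, t.2) end.
have h_inj : injective h.
  move=> [[t e]|[[s t] e]] [[t' e']|[[s' t'] e']] //=.
    by move=> [/val_inj -> ->].
  by move=> [/val_inj -> /val_inj -> ->].
pose dd (t : ('I_n * label q) + ('I_m * 'I_m * label q)) :=
  match t with inl t => d t | inr t => d' t end.
have dd0 := param_basis_free h_inj (c := dd).
exists y1; rewrite big1 ?add0r // => t _.
rewrite -[d t]/(dd (inl t)) dd0 ?scale0r // big_sumType /= -[RHS]d0 !mulr_sumr.
congr (_ + _); apply: eq_bigr => u _; rewrite fiber_scalerAr.
  by rewrite -param_basis_th2.
by rewrite -param_basis_th1.
Qed.

Lemma fiber_cohen_macaulay (Z0 : pred 'I_4) (i j : 'I_4) :
  (forall p, f p = 0 -> zero_vars Z0 p = 0) -> ~~ Z0 i -> ~~ Z0 j -> i != j ->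
  fiberF_comp 1 (f th1) -> fiberF_comp 1 (f th2) ->
  zero_vars predT th1 = 0 -> zero_vars predT th2 = 0 ->
  fiberF_cohen_macaulay K a b c.
Proof.
move=> ker0 nZi nZj ij th1_1 th2_1 th1_0 th2_0.
have col := fiber_collapse nuP.
exists 2%N; split; [split|split].
- exact: zero_vars_chain ker0 nZi nZj ij.
- by move=> n C; apply: prime_chain_collapse.
- exists [:: f th1; f th2]; split=> //; split.
    move=> x; rewrite !inE => xth.
    have x1 : fiberF_comp 1 x by case/orP: xth => /eqP ->.
    by split; [exists 1%N|apply: ideal_gen_mem; exists 1%N].
  have gen1 (x : F) : ideal_gen (fun y => y \in [:: f th1]) x -> exists z, x = f th1
    * z.
    move=> [n [d [s [hs ->]]]]; exists (\sum_l d l); rewrite mulr_sumr.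
    by apply: eq_bigr => l _; have := hs l; rewrite inE => /eqP ->; rewrite mulrC.
  have ker1 p : f p = 0 -> zero_vars predT p = 0.
    by move=> /ker0 p0; rewrite -(zero_vars_comp (Z := Z0) (Z' := predT)) // p0 rmorph0.
  split=> [[|[|//]] _ x /=|[n [d [s [hs h1]]]]].
  - move=> [n [d [s [hs]]]]; rewrite big1 => [/param_regular1 ->|l _].
      exact: ideal_gen0.
    by have := hs l.
  - move=> /gen1[z /param_regular2[z' ->]]; rewrite mulrC; apply: ideal_genM.
    by apply: ideal_gen_mem; rewrite inE.
  (* Properness: both parameters lie in the prime generated by all the variables, which does not
     contain 1. *)
  - have [[P0 nP1] PD PM _] := zero_vars_primeP ker1.
    apply: nP1; rewrite h1; elim/big_ind: _ => // l _; apply: PM.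
    have := hs l; rewrite !inE => /orP[]/eqP ->; exact/zero_vars_primeE.
- by move=> s [_]; apply: regular_seq_collapse.
Qed.

End CohenMacaulay.

(** * Exponents and Hilbert series *)

(** As a function of n, truncated n - l is a ramp with its corner at l, so its second difference is
    1 at the corner and 0 elsewhere. Multiplying a series by (1 - t)^2 takes second differences. *)
Lemma second_difference_sub (n l : nat) :
  ((n.+2 - l)%N%:R - 2%:R * (n.+1 - l)%N%:R + (n - l)%N%:R : int) =
  (n.+2 == l.+1)%:R.
Proof.
have [lt_ln|lt_nl|e] := ltngtP n.+1 l.
- have -> : (n.+2 - l = 0)%N by lia.
  have -> : (n.+1 - l = 0)%N by lia.
  have -> : (n - l = 0)%N by lia.
  by have -> : (n.+2 == l.+1) = false by lia.
- have -> : (n.+2 == l.+1) = false by lia.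
  by rewrite !natz; lia.
- rewrite -e eqxx subSnn subnn; have -> : (n - n.+1 = 0)%N by lia.
  by [].
Qed.

Lemma hilbert_series_eq (q : nat) :
  series_eq_frac (fun k => k.+1 + 2 * \sum_(l < q) (k - l))%N
    (1 + 2%:R * \sum_(1 <= i < q.+1) 'X^i) ((1 - 'X) ^+ 2).
Proof.
have QE : (1 - 'X) ^+ 2 = 1 - 'X *+ 2 + 'X^2 :> {poly int}.
  by rewrite sqrrB expr1n mul1r.
have Q i : ((1 - 'X) ^+ 2 : {poly int})`_i =
    (i == 0)%N%:R - 2%:R * (i == 1)%N%:R + (i == 2)%N%:R.
  by rewrite QE coefD coefB coef1 coefMn coefX coefXn mulr_natl.
have P n : (1 + 2%:R * \sum_(1 <= i < q.+1) 'X^i : {poly int})`_n =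
    (n == 0)%N%:R + 2%:R * \sum_(l < q) (n == l.+1)%N%:R.
  rewrite coefD coef1 big_add1 big_mkord !mulr_natl coefMn coef_sum.
  by congr (_ + _ *+ 2); apply: eq_bigr => l _; rewrite coefXn.
pose H k : int := k%:R + 1 + 2%:R * \sum_(l < q) (k - l)%N%:R.
have HE k : (k.+1 + 2 * \sum_(l < q) (k - l))%N%:R = H k :> int.
  by rewrite natrD natrM natr_sum -natr1.
(* Degrees 0 and 1 involve fewer than three values of the Hilbert function and are checked directly.
   From degree 2 on, the summand k + 1 has zero second difference and only the ramps contribute. *)
case=> [|[|n]]; rewrite P.
- rewrite big_ord1 Q HE /H /=.
  by rewrite !big1 // => l _; rewrite sub0n.
- rewrite !big_ord_recl big_ord0 !Q !HE /H /= subn0 /bump /= subnn.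
  rewrite [\sum_(i < q) (0 - i)%N%:R]big1 => [|l _]; last by rewrite sub0n.
  rewrite (eq_bigr (fun l : 'I_q => (1 == l.+1)%N%:R : int)) => [|[[|l] ?] _] //.
  by rewrite !mulr0 !addr0 !mul1r; ring.
rewrite !big_ord_recl [X in _ + (_ + (_ + X))]big1 => [|i _];
  last by rewrite Q /= !mul0r.
rewrite !Q !HE /= /bump /= !subSS !subn0 /H.
under [in RHS]eq_bigr do rewrite -second_difference_sub.
rewrite !big_split /= sumrN -mulr_sumr -!natr1.
set s2 := \sum_(i < q) (n.+2 - _)%N%:R; set s1 := \sum_(i < q) (n.+1 - _)%N%:R.
set s0 := \sum_(i < q) (n - _)%N%:R; ring.
Qed.

Definition mon4 (p i j l : nat) : 'X_{1..4} :=
  (U_(inord 0) *+ p + U_(inord 1) *+ i + U_(inord 2) *+ j + U_(inord 3) *+ l)%MM.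

Lemma mon4E p i j l : [/\ mon4 p i j l (inord 0) = p, mon4 p i j l (inord 1) = i,
  mon4 p i j l (inord 2) = j & mon4 p i j l (inord 3) = l].
Proof.
by split; rewrite /mon4 !mnmDE !mulmnE !mnm1E -!val_eqE /= !inordK // !mul0n mul1n
  ?addn0.
Qed.

Lemma mon4_inj p i j l p' i' j' l' :
  mon4 p i j l = mon4 p' i' j' l' -> [/\ p = p', i = i', j = j' & l = l'].
Proof.
move=> e; have := mon4E p i j l; rewrite e.
by have [-> -> -> ->] := mon4E p' i' j' l'; case=> -> -> -> ->.
Qed.

Lemma mon4_surj (gamma : 'X_{1..4}) :
  gamma = mon4 (gamma (inord 0)) (gamma (inord 1)) (gamma (inord 2)) (gamma (inord 3)).
Proof.
apply/mnmP=> k; set m := mon4 _ _ _ _.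
have [e0 e1 e2 e3] := mon4E (gamma (inord 0)) (gamma (inord 1))
  (gamma (inord 2)) (gamma (inord 3)).
have := inord_val k; case: k => -[|[|[|[|//]]]] ? /= <-; by rewrite ?e0 ?e1 ?e2 ?e3.
Qed.

Lemma mdeg_mon4 p i j l : mdeg (mon4 p i j l) = (p + i + j + l)%N.
Proof. by rewrite !mdegD !mdegMn !mdeg1 !mul1n. Qed.

Lemma mpolyX_mon4 (K : fieldType) p i j l : 'X_[mon4 p i j l] =
  zvar K 1 ^+ p * zvar K 2 ^+ i * zvar K 3 ^+ j * zvar K 4 ^+ l.
Proof. by rewrite !mpolyXD -!mpolyXn. Qed.

Lemma expo2E i j : expo2 i j (inord 0) = i /\ expo2 i j (inord 1) = j.
Proof.
by split; rewrite /expo2 !mnmDE !mulmnE !mnm1E -!val_eqE /= !inordK // ?mul0n mul1n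
  ?addn0.
Qed.

Lemma expo2_le i j i' j' : (expo2 i j <= expo2 i' j')%MM = (i <= i')%N && (j <= j')%N.
Proof.
have [e0 e1] := expo2E i j; have [e0' e1'] := expo2E i' j'.
apply/mnm_lepP/andP => [h|[h0 h1] k].
  by have := h (inord 0); have := h (inord 1); rewrite e0 e1 e0' e1'.
have := inord_val k; case: k => -[|[|//]] ? /= <-; by rewrite ?e0 ?e1 ?e0' ?e1'.
Qed.

Section Exponents.
Variables a b c : nat.

Lemma expo_mon4 p i j l :
  expo a b c (mon4 p i j l) = expo2 (c * p + b * i + a * j) (a * i + b * j + c * l).
Proof.
have expoM k n : expo a b c (U_(k) *+ n)%MM = (tnth (gexp a b c) k *+ n)%MM.
  elim: n => [|n IHn]; first by rewrite !mulm0n expo0.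
  by rewrite !mulmS expoD IHn expoU.
rewrite /mon4 !expoD !expoM !(tnth_nth 0%MM) !inordK //=.
by apply/mnmP=> k; rewrite /expo2 !(mnmDE, mulmnE) !mnm1E; lia.
Qed.

(** Descent on the degree of [expo gamma]. If [gamma] is not in [N], some [ga'] lies strictly below
    it, and by induction [ga'] is [al]; then [gamma] would be strictly above [al] and also below
    it. *)
Lemma minimal_of_antichain (N : 'X_{1..4} -> Prop) :
  (forall gamma, N gamma \/
    exists gamma', [/\ mdeg gamma' = mdeg gamma,
      (expo a b c gamma' <= expo a b c gamma)%MM &
      expo a b c gamma' != expo a b c gamma]) ->
  (forall al be, N al -> N be -> mdeg al = mdeg be ->
    (expo a b c al <= expo a b c be)%MM -> al = be) ->
  forall gamma al, N al -> mdeg gamma = mdeg al ->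
    (expo a b c gamma <= expo a b c al)%MM -> gamma = al.
Proof.
move=> dec anti gamma al Nal; have [n] := ubnP (mdeg (expo a b c gamma)).
elim: n gamma => // n IHn gamma lt_n dga le_ga.
have [Nga|[ga' [dga' le_ga' ne_ga']]] := dec gamma; first exact: anti.
have lt_ga' : (mdeg (expo a b c ga') < mdeg (expo a b c gamma))%N.
  rewrite -(submK le_ga') mdegD -[X in (X < _)%N]add0n ltn_add2r lt0n mdeg_eq0.
  by apply: contraNneq ne_ga' => e0; rewrite -[expo a b c gamma](submK le_ga') e0 add0m.
have ga'al : ga' = al.
  apply: IHn; [exact: leq_trans lt_ga' lt_n | by rewrite dga' |].
  exact: lepm_trans le_ga' le_ga.
suff : (mdeg (expo a b c gamma) <= mdeg (expo a b c ga'))%N by rewrite leqNgt lt_ga'.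
by rewrite ga'al -(submK le_ga) mdegD leq_addl.
Qed.

End Exponents.

Lemma basis_exponents_antichain a b c q (nu : nat * nat * label q -> 'X_{1..4}) :
  injective nu -> (forall x, mdeg (nu x) = index_deg x) ->
  (forall gamma, (exists x, gamma = nu x) \/
    exists gamma', [/\ mdeg gamma' = mdeg gamma,
      (expo a b c gamma' <= expo a b c gamma)%MM &
      expo a b c gamma' != expo a b c gamma]) ->
  (forall x y, mdeg (nu x) = mdeg (nu y) ->
    (expo a b c (nu x) <= expo a b c (nu y))%MM -> nu x = nu y) ->
  basis_exponents a b c nu.
Proof.
move=> inj dg dec anti; split=> // gamma x.
apply: (minimal_of_antichain dec); last by exists x.
by move=> _ _ [y ->] [z ->]; apply: anti.
Qed.

(** Given the two componentwise inequalities, strictness for the sums says that the exponents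
    differ. *)
Lemma expo_mon4_lt a b c p i j l p' i' j' l' :
  (p' + i' + j' + l' = p + i + j + l)%N ->
  (c * p' + b * i' + a * j' <= c * p + b * i + a * j)%N ->
  (a * i' + b * j' + c * l' <= a * i + b * j + c * l)%N ->
  (c * p' + b * i' + a * j' + (a * i' + b * j' + c * l') <
     c * p + b * i + a * j + (a * i + b * j + c * l))%N ->
  exists gamma', [/\ mdeg gamma' = mdeg (mon4 p i j l),
      (expo a b c gamma' <= expo a b c (mon4 p i j l))%MM &
      expo a b c gamma' != expo a b c (mon4 p i j l)].
Proof.
move=> dg lex ley lt; exists (mon4 p' i' j' l'); split.
- by rewrite !mdeg_mon4.
- by rewrite !expo_mon4 expo2_le lex ley.
- apply/eqP=> e; suff: ~~ (expo a b c (mon4 p i j l) <= expo a b c (mon4 p' i' j'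
  l'))%MM.
    by rewrite e lepm_refl.
  by rewrite !expo_mon4 expo2_le; lia.
Qed.

Lemma mpolyX_mon4_ideal (K : fieldType) (J : seq {mpoly K[4]}) p i j l p' i' j' l' :
  'X_[mon4 p' i' j' l'] \in J ->
  (p' <= p)%N -> (i' <= i)%N -> (j' <= j)%N -> (l' <= l)%N ->
  ideal_gen (fun r => r \in J) 'X_[mon4 p i j l].
Proof.
move=> memJ lep lei lej lel.
have -> : mon4 p i j l =
    (mon4 (p - p') (i - i') (j - j') (l - l') + mon4 p' i' j' l')%MM.
  by apply/mnmP=> k; rewrite /mon4 !(mnmDE, mulmnE); nia.
by rewrite mpolyXD; apply/ideal_genM/ideal_gen_mem.
Qed.

Section Fiber.
Variables (K : fieldType) (a b c : nat).
Local Notation S := {mpoly K[4]}.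
Local Notation f := (@fiber_map K a b c).

Lemma zero_vars_ideal (Z : pred 'I_4) (J : seq S) p :
  (forall r, r \in J -> zero_vars Z r = 0) ->
  ideal_gen (fun r => r \in J) p -> zero_vars Z p = 0.
Proof.
move=> J0 [n [d [s [hs ->]]]]; rewrite rmorph_sum big1 // => i _.
by rewrite rmorphM /= (J0 _ (hs i)) mulr0.
Qed.

Lemma zero_vars_zvar (Z : pred 'I_4) i :
  zero_vars Z (zvar K i) = if Z (inord i.-1) then 0 else zvar K i.
Proof. exact: zero_varsX. Qed.

Lemma fiberF_comp_zvar i : fiberF_comp 1 (f (zvar K i)).
Proof.
apply/fiber_compP; exists (zvar K i) => // al.
by rewrite msuppX inE => /eqP ->; rewrite mdeg1.
Qed.

Lemma fiberF_compD k (x y : fiberF K a b c) :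
  fiberF_comp k x -> fiberF_comp k y -> fiberF_comp k (x + y).
Proof.
move=> /fiber_compP[p dp ->] /fiber_compP[r dr ->]; apply/fiber_compP.
exists (p + r); last by rewrite rmorphD.
by move=> al /msuppD_le; rewrite mem_cat => /orP[/dp|/dr].
Qed.

End Fiber.

(** * Case (a) *)

Section CaseA.
Variables (K : fieldType) (a b c : nat).
Hypotheses (ha : (0 < a)%N) (hab : (a < b)%N) (hbc : (b < c)%N) (hc : (c <= 2 * a)%N).
Local Notation f := (@fiber_map K a b c).
Local Notation z := (zvar K).

Definition nu_a (x : nat * nat * label 1) : 'X_{1..4} :=
  let: (s, t, e) := x in
  match e with
  | inl _ => mon4 s 0 0 t
  | inr (inl _) => mon4 s 1 0 t
  | inr (inr _) => mon4 s 0 1 t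
  end.

Lemma nu_a_ex p i j l : (i + j <= 1)%N -> exists x, mon4 p i j l = nu_a x.
Proof.
case: i j => [|[|//]] [|[|//]] // _.
- by exists (p, l, inl tt).
- by exists (p, l, inr (inr ord0)).
- by exists (p, l, inr (inl ord0)).
Qed.

(** A quadratic monomial in z2, z3 can be traded for z1 z4: since c <= 2a < a + b < 2b, the product
    x^c y^c properly divides the images of z2^2, z2 z3 and z3^2. *)
Lemma nu_aP : basis_exponents a b c nu_a.
Proof.
apply: basis_exponents_antichain.
- move=> [[s t] [[]|[e|e]]] [[s' t'] [[]|[e'|e']]] /= /mon4_inj[-> // _ _ ->] //;
  by rewrite [e]ord1 [e']ord1.
- move=> [[s t] [[]|[e|e]]]; rewrite mdeg_mon4 /index_deg /label_deg /= ?[e]ord1 /=;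
  lia.
- move=> gamma; rewrite [gamma]mon4_surj; move: (gamma _) (gamma _) (gamma _) (gamma _).
  move=> l j i p; have [le1|] := leqP (i + j) 1; first by left; apply: nu_a_ex.
  move=> lt1; right; case: i lt1 => [|[|i]] lt1.
  + case: j lt1 => [|[|j]] // _.
    by apply: (expo_mon4_lt (p' := p.+1) (i' := 0) (j' := j) (l' := l.+1)); nia.
  + case: j lt1 => [|j] // _.
    by apply: (expo_mon4_lt (p' := p.+1) (i' := 0) (j' := j) (l' := l.+1)); nia.
  + by apply: (expo_mon4_lt (p' := p.+1) (i' := i) (j' := j) (l' := l.+1)); nia.
(* z2 and z3 contribute less than c to either exponent, so the x exponent orders the powers of z1
   and the y exponent those of z4. Once these agree, b <= a is the only way for distinct labels to
   be comparable. *)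
- move=> [[s t] [[]|[e|e]]] [[s' t'] [[]|[e'|e']]] /=;
  rewrite !mdeg_mon4 !expo_mon4 expo2_le => dg /andP[lex ley];
  have ss' : (s <= s')%N by nia.
  all: have tt' : (t <= t')%N by nia.
  all: have es : s = s' by lia.
  all: have et : t = t' by lia.
  all: by subst s' t'; first [done|exfalso; lia].
Qed.

Definition relations_a : seq {mpoly K[4]} := [:: z 2 * z 3; z 2 ^+ 2; z 3 ^+ 2].

Lemma notin_nu_a i j : (1 < i + j)%N -> f 'X_[mon4 0 i j 0] = 0.
Proof.
move=> lt1; apply: (fiber_map_notin K nu_aP) => -[[[s t] [[]|[e|e]]]] /=;
by move=> /mon4_inj[_ ? ? _]; lia.
Qed.

Lemma relations_aE : relations_a =
  [:: 'X_[mon4 0 1 1 0]; 'X_[mon4 0 2 0 0]; 'X_[mon4 0 0 2 0]].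
Proof. by rewrite !mpolyX_mon4 /relations_a !expr0 !mul1r !mulr1. Qed.

Lemma fiber_map_relations_a p : p \in relations_a -> f p = 0.
Proof. by rewrite relations_aE !inE => /or3P[] /eqP ->; apply: notin_nu_a. Qed.

Lemma relations_a_dvd gamma :
  ~ (exists x, gamma = nu_a x) -> ideal_gen (fun p => p \in relations_a) 'X_[gamma].
Proof.
rewrite relations_aE [gamma]mon4_surj; move: (gamma _) (gamma _) (gamma _) (gamma _).
move=> l j i p; have [le1 []|lt1 _] := leqP (i + j) 1; first exact: nu_a_ex.
have [i2|i2] := leqP 2 i.
  by apply: (mpolyX_mon4_ideal (p' := 0) (i' := 2) (j' := 0) (l' := 0)) => //;
     rewrite !inE eqxx ?orbT.
have [j2|j2] := leqP 2 j.
  by apply: (mpolyX_mon4_ideal (p' := 0) (i' := 0) (j' := 2) (l' := 0)) => //;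
     rewrite !inE eqxx ?orbT.
by apply: (mpolyX_mon4_ideal (p' := 0) (i' := 1) (j' := 1) (l' := 0)) => //;
   [rewrite !inE eqxx ?orbT|lia|lia].
Qed.

Lemma fiber_cone_case_a :
  [/\ fiberF_presented_by a b c relations_a,
      fiberF_hilbert_eq K a b c (1 + 2%:R * 'X) ((1 - 'X) ^+ 2) &
      fiberF_cohen_macaulay K a b c].
Proof.
split; first exact: (fiber_presented nu_aP fiber_map_relations_a relations_a_dvd).
  exists (fun k => k.+1 + 2 * \sum_(l < 1) (k - l))%N.
  split; first exact: (fiber_has_dim K nu_aP).
  by have := hilbert_series_eq 1; rewrite big_nat1 expr1.
pose bas (e : label 1) : {mpoly K[4]} :=
  match e with inl _ => 1 | inr (inl _) => z 2 | inr (inr _) => z 3 end.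
(* With indices from 0, this is the prime (z2, z3), which contains all the relations; z1 and z4 then
   extend the chain. *)
pose Z0 : pred 'I_4 := fun i => (i == inord 1) || (i == inord 2).
have ZE i k : (i < 4)%N -> (k < 4)%N -> ((inord i : 'I_4) == inord k) = (i == k).
  by move=> i4 k4; rewrite -val_eqE /= !inordK.
apply: (fiber_cohen_macaulay nu_aP (th1 := z 1) (th2 := z 4) (bas := bas) _
  (Z0 := Z0) (i := inord 0) (j := inord 3)).
(* Here the family built from the parameters is the family of normal monomials itself. *)
- move=> n x lt_n; have [t tx] := filtered_valP lt_n.
  have -> : f 'X_[nu_a x] = param_basis a b c (z 1) (z 4) bas (filtered_val t).
    rewrite tx; case: x {lt_n tx} => [[s t'] [[]|[e|e]]];
    by rewrite /param_basis /nu_a mpolyX_mon4 /=; congr (f _); ring.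
  exact: (in_span_mem (fun t : filtered_index 1 n =>
    param_basis a b c (z 1) (z 4) bas (filtered_val t))).
- move=> p /(fiber_map_ker nu_aP fiber_map_relations_a relations_a_dvd p);
  apply: zero_vars_ideal => r.
  rewrite !inE => /or3P[] /eqP ->;
  by rewrite ?rmorphXn ?rmorphM /= !zero_vars_zvar /Z0 !ZE //= ?expr0n ?mulr0.
- by rewrite /Z0 !ZE.
- by rewrite /Z0 !ZE.
- by rewrite ZE.
- exact: fiberF_comp_zvar.
- exact: fiberF_comp_zvar.
- by rewrite zero_vars_zvar.
- by rewrite zero_vars_zvar.
Qed.

End CaseA.

(** * Case (b) *)

Section ParameterIdentities.
Variable R : comPzRingType.
Implicit Types u v x y : R.

(** Applied to z1, z3 and to z4, z2: from the power [q] on, the parameter acts on powers of one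
    variable as that variable, so high powers reduce to the module basis. *)
Lemma mul_param_expr u x q l :
  u * x ^+ q = 0 -> (q <= l)%N -> (u + x) * x ^+ l = x ^+ l.+1.
Proof.
by move=> u0 le_ql; rewrite mulrDl -exprS -{1}(subnKC le_ql) exprD mulrA u0 mul0r add0r.
Qed.

(** When uv = 0, the product (u + y)(x + v) equals ux + yx + yv. With u = z1 and v = z4 this
    rewrites z2 z3 by terms that each have a parameter as a factor. *)
Lemma mul_params u v x y : u * v = 0 ->
  x * y = (u + y) * x + (x + v) * y - (u + y) * (x + v).
Proof. by move=> uv0; rewrite !mulrDl !mulrDr uv0; ring. Qed.

Lemma mul_params_expr p t x y l : x * y = p * x + t * y - p * t ->
  x * y ^+ l.+1 = p * (x * y ^+ l) + t * y ^+ l.+1 - p * (t * y ^+ l).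
Proof. by move=> e; rewrite exprS mulrA e; ring. Qed.

End ParameterIdentities.

Section CaseB.
Variables (K : fieldType) (a b c d q : nat).
Hypotheses (bE : b = (a + d)%N) (d_gt0 : (0 < d)%N) (q_gt0 : (0 < q)%N).
Hypotheses (le_aq : (a <= q * d)%N) (lt_qa : (q * d < a + d)%N).
Hypothesis (lt_qc : (q * d + d + a < c)%N).
Local Notation f := (@fiber_map K a b c).
Local Notation z := (zvar K).

(** Here d = b - a and q = r - 1. The condition says that z1^p z2^i z3^j z4^l is divisible by none
    of z1 z4, z1 z3^q and z2^q z4. *)
Definition normal_b (p i j l : nat) : Prop :=
  [/\ (0 < p -> l = 0)%N, (0 < p -> j < q)%N & (0 < l -> i < q)%N].

(** If p' = 0, then l > l', p = 0 and i < q; each of the l - l' steps gains c - a > (q + 1)d in the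
    y exponent, whereas j' - j is at most i + l - l'. If p' > 0, then l' = 0 and j' < q; the y
    exponent on the left is a(i' + j') + dj' with dj' <= (q - 1)d < a, while i + j + l > i' + j'. *)
Lemma normal_b_lt p i j l p' i' j' l' :
  normal_b p i j l -> normal_b p' i' j' l' ->
  (p + i + j + l = p' + i' + j' + l')%N -> (p + l' < p' + l)%N ->
  (a * i' + b * j' + c * l' < a * i + b * j + c * l)%N.
Proof.
move=> [pl pj li] [pl' pj' li'] dg lt.
have [p'0|p'_gt0] := posnP p'.
  have l_gt0 : (0 < l)%N by lia.
  have p0 : p = 0%N by have [//|/pl] := posnP p; lia.
  have [m lE] : exists m, l = (l' + 1 + m)%N by exists (l - l' - 1)%N; lia.
  have [e cE] : exists e, c = (a + d + q * d + e.+1)%N.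
    by exists (c - (a + d + q * d) - 1)%N; lia.
  have iq := li l_gt0.
  have di : (d * i <= q * d)%N by rewrite mulnC leq_mul2r (ltnW iq) orbT.
  have jE : (j' + i' = i + j + 1 + m)%N by lia.
  have dj := congr1 (muln d) jE; have aj := congr1 (muln a) jE.
  have em : (0 <= m * (q * d + e))%N by [].
  have di' : (0 <= d * i')%N by [].
  by rewrite bE cE lE; lia.
have l'0 := pl' p'_gt0; have jq := pj' p'_gt0.
have le_s : (i' + j' + 1 <= i + j + l)%N.
  by have [l0|l_gt0] := posnP l; [|have p0 : p = 0%N by have [//|/pl] := posnP p;
    lia]; lia.
have dj : (d * j' + d <= q * d)%N by rewrite -mulnSr mulnC leq_mul2r jq orbT.
have as_ := leq_mul (leqnn a) le_s.
have cl : (a * l <= c * l)%N by rewrite leq_mul2r; apply/orP; right; lia.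
by rewrite l'0 bE; lia.
Qed.

(** By [normal_b_lt] and the symmetry exchanging x and y, comparable monomials have equal p - l. One
    of p, l is 0, so p and l agree separately, and the exponents then compare i with i' and j with
    j'. *)
Lemma normal_b_antichain p i j l p' i' j' l' :
  normal_b p i j l -> normal_b p' i' j' l' ->
  (p + i + j + l = p' + i' + j' + l')%N ->
  (c * p + b * i + a * j <= c * p' + b * i' + a * j')%N ->
  (a * i + b * j + c * l <= a * i' + b * j' + c * l')%N ->
  [/\ p = p', i = i', j = j' & l = l'].
Proof.
move=> N N' dg lex ley.
have flip p1 i1 j1 l1 : normal_b p1 i1 j1 l1 -> normal_b l1 j1 i1 p1.
  by move=> [h1 h2 h3]; split=> // l_gt0; have [//|/h1] := posnP p1; lia.
have [lt|gt|eq] := ltngtP (p + l') (p' + l).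
- by have := normal_b_lt N N' dg lt; lia.
- have dg' : (l + j + i + p = l' + j' + i' + p')%N by lia.
  by have := normal_b_lt (flip _ _ _ _ N) (flip _ _ _ _ N') dg'; lia.
have [pl _ _] := N; have [pl' _ _] := N'.
have pp : p = p'.
  have [p0|/pl l0] := posnP p; have [p0'|/pl' l0'] := posnP p'; lia.
have ll : l = l' by lia.
subst p' l'; have ij : (i + j = i' + j')%N by lia.
have aij := congr1 (muln a) ij.
have di : (i <= i')%N by rewrite -(leq_pmul2l d_gt0); move: lex; rewrite bE; lia.
have dj : (j <= j')%N by rewrite -(leq_pmul2l d_gt0); move: ley; rewrite bE; lia.
by split; lia.
Qed.

(* The label only records the degree: [inr (inl l)] stands for the monomials
   z1^(s+1) z2^t z3^l here, and for multiples of z3^(l+1) in [bas_b]. *)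
Definition nu_b (x : nat * nat * label q) : 'X_{1..4} :=
  let: (s, t, e) := x in
  match e with
  | inl _ => mon4 0 t s 0
  | inr (inl l) => mon4 s.+1 t l 0
  | inr (inr l) => mon4 0 l s t.+1
  end.

Lemma nu_b_ex p i j l : normal_b p i j l -> exists x, mon4 p i j l = nu_b x.
Proof.
case: p => [|p] [pl pj li].
  case: l pl li => [|l] pl li; first by exists (j, i, inl tt).
  by exists (j, l, inr (inr (Ordinal (li isT)))).
by rewrite pl //; exists (p, i, inr (inl (Ordinal (pj isT)))).
Qed.

Lemma nu_b_normal x : exists p i j l, nu_b x = mon4 p i j l /\ normal_b p i j l.
Proof.
case: x => [[s t] [[]|[e|e]]].
- by exists 0%N, t, s, 0%N.
- by exists s.+1, t, (e : nat), 0%N; split=> //; split.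
- by exists 0%N, (e : nat), s, t.+1; split=> //; split.
Qed.

Lemma not_normal_b p i j l : ~ normal_b p i j l ->
  [\/ (0 < p)%N /\ (0 < l)%N, (0 < p)%N /\ (q <= j)%N | (0 < l)%N /\ (q <= i)%N].
Proof.
move=> nN; have [p0|p_gt0] := posnP p; have [l0|l_gt0] := posnP l.
- by case: nN; rewrite p0 l0; split.
- have [iq|iq] := ltnP i q; last by constructor 3.
  by case: nN; rewrite p0; split.
- have [jq|jq] := ltnP j q; last by constructor 2.
  by case: nN; rewrite l0; split.
- by constructor 1.
Qed.

(** The three relations are witnessed by trading z1 z4 for z2 z3, z1 z3^q for z2^(q+1), and z2^q z4
    for z3^(q+1). The last two trades use a <= qd in one exponent and c > qd + d + a in the
    other. *)
Lemma nu_bP : basis_exponents a b c nu_b.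
Proof.
apply: basis_exponents_antichain.
- move=> [[s t] [[]|[e|e]]] [[s' t'] [[]|[e'|e']]] /= /mon4_inj[] //.
  + by move=> _ -> -> _.
  + by move=> [->] -> /val_inj -> _.
  + by move=> _ /val_inj -> -> [->].
- by move=> [[s t] [[]|[e|e]]]; rewrite mdeg_mon4 /index_deg /label_deg /=; lia.
- move=> gamma; rewrite [gamma]mon4_surj; move: (gamma _) (gamma _) (gamma _) (gamma _).
  move=> l j i p; have [N|/not_normal_b nN] := pselect (normal_b p i j l).
    by left; apply: nu_b_ex.
  right; case: nN => [[p0 l0]|[p0 jq]|[l0 iq]].
  + have [p' pE] : exists p', p = p'.+1 by exists p.-1; lia.
    have [l' lE] : exists l', l = l'.+1 by exists l.-1; lia.
    rewrite pE lE bE.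
    by apply: (expo_mon4_lt (p' := p') (i' := i.+1) (j' := j.+1) (l' := l')); lia.
  + have [p' pE] : exists p', p = p'.+1 by exists p.-1; lia.
    have [j' jE] : exists j', j = (j' + q)%N by exists (j - q)%N; lia.
    rewrite pE jE bE.
    by apply: (expo_mon4_lt (p' := p') (i' := (i + q.+1)%N) (j' := j') (l' := l)); lia.
  + have [l' lE] : exists l', l = l'.+1 by exists l.-1; lia.
    have [i' iE] : exists i', i = (i' + q)%N by exists (i - q)%N; lia.
    rewrite iE lE bE.
    by apply: (expo_mon4_lt (p' := p) (i' := i') (j' := (j + q.+1)%N) (l' := l')); lia.
- move=> x y; have [p [i [j [l [-> N]]]]] := nu_b_normal x.
  have [p' [i' [j' [l' [-> N']]]]] := nu_b_normal y.
  rewrite !mdeg_mon4 !expo_mon4 expo2_le => dg /andP[lex ley].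
  by have [-> -> -> ->] := normal_b_antichain N N' dg lex ley.
Qed.

Definition relations_b : seq {mpoly K[4]} :=
  [:: z 1 * z 3 ^+ q; z 2 ^+ q * z 4; z 1 * z 4].

Lemma relations_bE : relations_b =
  [:: 'X_[mon4 1 0 q 0]; 'X_[mon4 0 q 0 1]; 'X_[mon4 1 0 0 1]].
Proof. by rewrite !mpolyX_mon4 /relations_b !expr0 !mul1r !mulr1. Qed.

Lemma fiber_map_relations_b p : p \in relations_b -> f p = 0.
Proof.
rewrite relations_bE !inE => h; have [p' [i' [j' [l' [-> nN]]]]] :
    exists p' i' j' l', p = 'X_[mon4 p' i' j' l'] /\ ~ normal_b p' i' j' l'.
  case/or3P: h => /eqP ->; do 4!eexists; (split; first by []) => -[h1 h2 h3].
  - by have := h2 isT; rewrite ltnn.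
  - by have := h3 isT; rewrite ltnn.
  - by have := h1 isT.
apply: (fiber_map_notin K nu_bP) => -[x];
  have [p1 [i1 [j1 [l1 [-> N]]]]] := nu_b_normal x.
by move=> /mon4_inj[? ? ? ?]; subst.
Qed.

Lemma relations_b_dvd gamma :
  ~ (exists x, gamma = nu_b x) -> ideal_gen (fun p => p \in relations_b) 'X_[gamma].
Proof.
rewrite relations_bE [gamma]mon4_surj; move: (gamma _) (gamma _) (gamma _) (gamma _).
move=> l j i p nex; have /not_normal_b nN : ~ normal_b p i j l.
  by move=> /nu_b_ex.
case: nN => -[h1 h2].
- by apply: (mpolyX_mon4_ideal (p' := 1) (i' := 0) (j' := 0) (l' := 1)) => //;
     rewrite !inE eqxx ?orbT.
- by apply: (mpolyX_mon4_ideal (p' := 1) (i' := 0) (j' := q) (l' := 0)) => //;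
     rewrite !inE eqxx ?orbT.
- by apply: (mpolyX_mon4_ideal (p' := 0) (i' := q) (j' := 0) (l' := 1)) => //;
     rewrite !inE eqxx ?orbT.
Qed.

Definition th1_b : {mpoly K[4]} := z 1 + z 3.
Definition th2_b : {mpoly K[4]} := z 2 + z 4.
Definition bas_b (e : label q) : {mpoly K[4]} :=
  match e with inl _ => 1 | inr (inl l) => z 3 ^+ l.+1 | inr (inr l) => z 2 ^+ l.+1 end.

Local Notation w := (param_basis a b c th1_b th2_b bas_b).

(** A filtration of F(I) by degree in the parameters and the module basis. Each variable is shown to
    raise the step by at most one, so monomials can be built up from 1. *)
Definition span_b (n : nat) (y : fiberF K a b c) : Prop :=
  in_span (fun t : filtered_index q n => w (filtered_val t)) y.

Lemma span_b_mem n x : (index_deg x < n)%N -> span_b n (w x).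
Proof.
move=> /filtered_valP[t <-].
exact: (in_span_mem (fun t : filtered_index q n => w (filtered_val t))).
Qed.

Lemma span_bM n n' u y :
  (forall x, (index_deg x < n)%N -> span_b n' (u * w x)) ->
  span_b n y -> span_b n' (u * y).
Proof.
move=> h [k ->]; rewrite mulr_sumr; apply: in_span_sum => t _.
rewrite fiber_scalerAr; apply/in_spanZ/h.
by case: t => [[[s t] e] /= lt_n]; exact: lt_n.
Qed.

Lemma span_b_mono n n' y : (n <= n')%N -> span_b n y -> span_b n' y.
Proof.
move=> le_n h; rewrite -[y]mul1r; apply: span_bM h => x lt_n.
by rewrite mul1r; apply: span_b_mem; apply: leq_trans le_n.
Qed.

Lemma span_bD n x y : span_b n x -> span_b n y -> span_b n (x + y).
Proof. exact: in_spanD. Qed.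

Lemma span_bN n x : span_b n x -> span_b n (- x).
Proof. by rewrite -scaleN1r; apply: in_spanZ. Qed.

Lemma span_b_th1 n y : span_b n y -> span_b n.+1 (f th1_b * y).
Proof.
by apply: span_bM => -[[s t] e] lt_n; rewrite -param_basis_th1; apply: span_b_mem.
Qed.

Lemma span_b_th2 n y : span_b n y -> span_b n.+1 (f th2_b * y).
Proof.
apply: span_bM => -[[s t] e] lt_n; rewrite -param_basis_th2; apply: span_b_mem.
by rewrite /index_deg /= addnS.
Qed.

Lemma fiber_map_th1_b : f th1_b = f (z 1) + f (z 3).
Proof. by rewrite rmorphD. Qed.

Lemma fiber_map_th2_b : f th2_b = f (z 2) + f (z 4).
Proof. by rewrite rmorphD. Qed.

Lemma span_b_z3 l : span_b l.+1 (f (z 3) ^+ l).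
Proof.
elim: l => [|l IHl].
  have -> : f (z 3) ^+ 0 = w (0, 0, inl tt)%N by rewrite /param_basis !mul1r rmorph1.
  exact: span_b_mem.
have [lt_lq|le_ql] := ltnP l q.
  have -> : f (z 3) ^+ l.+1 = w (0, 0, inr (inl (Ordinal lt_lq)))%N.
    by rewrite /param_basis !mul1r rmorphXn.
  exact: span_b_mem.
have -> : f (z 3) ^+ l.+1 = f th1_b * f (z 3) ^+ l; last exact: span_b_th1.
have r0 : f (z 1) * f (z 3) ^+ q = 0.
  by rewrite -rmorphXn -rmorphM; apply: fiber_map_relations_b; rewrite !inE eqxx.
by rewrite fiber_map_th1_b (mul_param_expr r0 le_ql).
Qed.

Lemma span_b_z2 l : span_b l.+1 (f (z 2) ^+ l).
Proof.
elim: l => [|l IHl]; first exact: span_b_z3 0.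
have [lt_lq|le_ql] := ltnP l q.
  have -> : f (z 2) ^+ l.+1 = w (0, 0, inr (inr (Ordinal lt_lq)))%N.
    by rewrite /param_basis !mul1r rmorphXn.
  exact: span_b_mem.
have -> : f (z 2) ^+ l.+1 = f th2_b * f (z 2) ^+ l; last exact: span_b_th2.
have r0 : f (z 4) * f (z 2) ^+ q = 0.
  by rewrite mulrC -rmorphXn -rmorphM; apply: fiber_map_relations_b;
    rewrite !inE eqxx orbT.
by rewrite fiber_map_th2_b addrC (mul_param_expr r0 le_ql).
Qed.

Lemma fiber_map_z1z4 : f (z 1) * f (z 4) = 0.
Proof. by rewrite -rmorphM; apply: fiber_map_relations_b; rewrite !inE eqxx !orbT. Qed.

Lemma fiber_map_z2z3 : f (z 2) * f (z 3) =
  f th1_b * f (z 2) + f th2_b * f (z 3) - f th1_b * f th2_b.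
Proof. rewrite fiber_map_th1_b fiber_map_th2_b; exact: mul_params fiber_map_z1z4. Qed.

Lemma fiber_map_z3z2 : f (z 3) * f (z 2) =
  f th2_b * f (z 3) + f th1_b * f (z 2) - f th2_b * f th1_b.
Proof.
rewrite fiber_map_th1_b fiber_map_th2_b [f (z 1) + _]addrC [f (z 2) + _]addrC.
by apply: mul_params; rewrite mulrC fiber_map_z1z4.
Qed.

(** The identity [mul_params_expr] leaves, behind a parameter, only a shorter mixed product and pure
    powers of z3. *)
Lemma span_b_z2z3 l : span_b l.+2 (f (z 2) * f (z 3) ^+ l).
Proof.
elim: l => [|l IHl]; first by rewrite mulr1; apply: span_b_z2 1%N.
rewrite (mul_params_expr l fiber_map_z2z3); apply: span_bD; first apply: span_bD.
- exact: span_b_th1.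
- exact/span_b_th2/span_b_z3.
- exact/span_bN/span_b_th1/span_b_th2/span_b_z3.
Qed.

Lemma span_b_z3z2 l : span_b l.+2 (f (z 3) * f (z 2) ^+ l).
Proof.
elim: l => [|l IHl]; first by rewrite mulr1; apply: span_b_z3 1%N.
rewrite (mul_params_expr l fiber_map_z3z2); apply: span_bD; first apply: span_bD.
- exact: span_b_th2.
- exact/span_b_th1/span_b_z2.
- exact/span_bN/span_b_th2/span_b_th1/span_b_z2.
Qed.

Lemma span_b_params u n s t e :
  span_b n (u * f (bas_b e)) -> span_b (s + t + n) (u * w (s, t, e)).
Proof.
move=> h; elim: s => [|s IHs].
  elim: t => [|t IHt]; first by rewrite /param_basis !mul1r.
  by rewrite param_basis_th2 mulrCA; apply: span_b_th2.
by rewrite param_basis_th1 mulrCA; apply: span_b_th1.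
Qed.

Lemma span_b_mulz2 n y : span_b n y -> span_b n.+1 (f (z 2) * y).
Proof.
apply: span_bM => -[[s t] e] lt_n.
apply: (@span_b_mono (s + t + (label_deg e).+2)); first by move: lt_n;
  rewrite /index_deg /=; lia.
apply: span_b_params; case: e {lt_n} => [[]|[l|l]] /=.
- by rewrite rmorph1 mulr1; apply: span_b_z2 1%N.
- by rewrite rmorphXn; apply: span_b_z2z3.
- by rewrite rmorphXn /= -exprS; apply: span_b_z2.
Qed.

Lemma span_b_mulz3 n y : span_b n y -> span_b n.+1 (f (z 3) * y).
Proof.
apply: span_bM => -[[s t] e] lt_n.
apply: (@span_b_mono (s + t + (label_deg e).+2)); first by move: lt_n;
  rewrite /index_deg /=; lia.
apply: span_b_params; case: e {lt_n} => [[]|[l|l]] /=.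
- by rewrite rmorph1 mulr1; apply: span_b_z3 1%N.
- by rewrite rmorphXn /= -exprS; apply: span_b_z3.
- by rewrite rmorphXn; apply: span_b_z3z2.
Qed.

Lemma span_b_mulz1 n y : span_b n y -> span_b n.+1 (f (z 1) * y).
Proof.
move=> h; have -> : z 1 = th1_b - z 3 by rewrite /th1_b addrK.
rewrite rmorphB mulrBl; apply: span_bD; first exact: span_b_th1.
exact/span_bN/span_b_mulz3.
Qed.

Lemma span_b_mulz4 n y : span_b n y -> span_b n.+1 (f (z 4) * y).
Proof.
move=> h; have -> : z 4 = th2_b - z 2 by rewrite /th2_b addrC addKr.
rewrite rmorphB mulrBl; apply: span_bD; first exact: span_b_th2.
exact/span_bN/span_b_mulz2.
Qed.

Lemma span_bX gamma : span_b (mdeg gamma).+1 (f 'X_[gamma]).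
Proof.
have mulX u m n y : (forall k x, span_b k x -> span_b k.+1 (f u * x)) ->
    span_b n y -> span_b (m + n) (f u ^+ m * y).
  move=> hu hy; elim: m => [|m IHm]; first by rewrite mul1r.
  by rewrite exprS -mulrA; apply: hu.
rewrite [gamma]mon4_surj; move: (gamma _) (gamma _) (gamma _) (gamma _) => l j i p.
rewrite mdeg_mon4 mpolyX_mon4 !rmorphM !rmorphXn /= -addn1 -!addnA -!mulrA.
rewrite -[f (z 4) ^+ l]mulr1.
apply: (mulX _ _ _ _ span_b_mulz1); apply: (mulX _ _ _ _ span_b_mulz2).
apply: (mulX _ _ _ _ span_b_mulz3); apply: (mulX _ _ _ _ span_b_mulz4).
exact: span_b_z2 0.
Qed.

Lemma fiber_cone_case_b :
  [/\ fiberF_presented_by a b c relations_b,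
      fiberF_hilbert_eq K a b c (1 + 2%:R * \sum_(1 <= i < q.+1) 'X^i) ((1 - 'X) ^+ 2) &
      fiberF_cohen_macaulay K a b c].
Proof.
split; first exact: (fiber_presented nu_bP fiber_map_relations_b relations_b_dvd).
  exists (fun k => k.+1 + 2 * \sum_(l < q) (k - l))%N.
  split; [exact: (fiber_has_dim K nu_bP)|exact: hilbert_series_eq].
(* With indices from 0, this is the prime (z1, z4): each relation is divisible by z1 or z4. *)
pose Z0 : pred 'I_4 := fun i => (i == inord 0) || (i == inord 3).
have ZE i k : (i < 4)%N -> (k < 4)%N -> ((inord i : 'I_4) == inord k) = (i == k).
  by move=> i4 k4; rewrite -val_eqE /= !inordK.
apply: (fiber_cohen_macaulay nu_bP (th1 := th1_b) (th2 := th2_b) (bas := bas_b) _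
  (Z0 := Z0) (i := inord 1) (j := inord 2)).
- move=> n x lt_n; apply: (@span_b_mono (index_deg x).+1) => //.
  by have [_ <- _ _] := nu_bP; apply: span_bX.
- move=> p /(fiber_map_ker nu_bP fiber_map_relations_b relations_b_dvd p);
  apply: zero_vars_ideal => r.
  rewrite !inE => /or3P[] /eqP ->;
  by rewrite rmorphM /= !zero_vars_zvar /Z0 !ZE //= ?mul0r ?mulr0.
- by rewrite /Z0 !ZE.
- by rewrite /Z0 !ZE.
- by rewrite ZE.
- by rewrite /th1_b rmorphD; apply: fiberF_compD; apply: fiberF_comp_zvar.
- by rewrite /th2_b rmorphD; apply: fiberF_compD; apply: fiberF_comp_zvar.
- by rewrite /th1_b rmorphD /= !zero_vars_zvar /= addr0.
- by rewrite /th2_b rmorphD /= !zero_vars_zvar /= addr0.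
Qed.

End CaseB.

(** * The ceiling r and the two cases together *)

Lemma ceil_divn (n d r : nat) : (0 < d)%N ->
  r%:Z = Num.ceil (n%:R / d%:R : rat) -> (n <= r * d)%N /\ (r * d < n + d)%N.
Proof.
move=> d0 rE; have dR : (0 : rat) < d%:R by rewrite ltr0n.
(* The quotient lies above r - 1 and is at most r; both bounds are multiplied by d. *)
have /andP[] := ceil_itv (n%:R / d%:R : rat).
rewrite -rE intrB -pmulrn ltrBlDr -[X in _ < _ + X](divff (lt0r_neq0 dR)) -mulrDl.
by rewrite ltr_pdivlMr // ler_pdivrMr // -natrD -!natrM ltr_nat ler_nat.
Qed.

Theorem theorem3p5 (K : fieldType) (a b c : nat)
    (ha : (0 < a)%N) (hab : (a < b)%N) (hbc : (b < c)%N) :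
  let z1 := zvar K 1%N in let z2 := zvar K 2%N in
  let z3 := zvar K 3%N in let z4 := zvar K 4%N in
  ((c <= 2 * a)%N ->
     [/\ fiberF_presented_by a b c [:: z2 * z3; z2 ^+ 2; z3 ^+ 2],
         fiberF_hilbert_eq K a b c (1 + 2%:R * 'X) ((1 - 'X) ^+ 2) &
         fiberF_cohen_macaulay K a b c]) /\
  (forall r : nat, r%:Z = Num.ceil (b%:R / (b%:R - a%:R) : rat) ->
     (r * (b - a) + a < c)%N ->
     [/\ fiberF_presented_by a b c
           [:: z1 * z3 ^+ (r - 1); z2 ^+ (r - 1) * z4; z1 * z4],
         fiberF_hilbert_eq K a b c
           (1 + 2%:R * \sum_(1 <= i < r) 'X^i) ((1 - 'X) ^+ 2) &
         fiberF_cohen_macaulay K a b c]).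
Proof.
move=> z1 z2 z3 z4; split=> [hc|r]; first exact: fiber_cone_case_a.
rewrite -natrB ?(ltnW hab) // => rE lt_rc.
have d_gt0 : (0 < b - a)%N by rewrite subn_gt0.
have [le_br lt_rb] := ceil_divn d_gt0 rE.
have [q rq] : exists q, r = q.+1.
  by case: r le_br {rE lt_rc lt_rb} => [|q]; [lia|exists q].
(* As b = a + (b - a), removing one multiple of b - a turns b <= r(b - a) < b + (b - a) into a <=
   q(b - a) < a + (b - a). *)
rewrite {}rq {rE} mulSn in le_br lt_rb lt_rc *.
have q_gt0 : (0 < q)%N by case: q le_br {lt_rb lt_rc} => [|//]; lia.
by rewrite subn1; apply: (@fiber_cone_case_b K a b c (b - a) q); lia.
Qed.
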